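(* For every $\Lambda\ge1$ there exists $c=c(\Lambda)>0$ such that the following holds. Let $\rho>0$ and let $X$ be an mm-space satisfying the condition $BIV(\Lambda,\frac56\rho,\frac5{12}\rho)$ and the restricted doubling condition $$\mu_X(B_{5\rho/3}(x))\le\Lambda\,\mu_X(B_{5\rho/6}(x))$$ for all $x\in\operatorname{supp}(\mu_X)$. Then $$\#^\rho_X(c\rho^{-2})\le N_X(\rho/24).$$
   Context: An mm-space is a triple $X=(X,d_X,\mu_X)$ where $(X,d_X)$ is a compact metric space and $\mu_X$ is a finite Borel measure on $X$. $B_r(x)=\{y: d_X(x,y)<r\}$. For $\rho>0$ the $\rho$-Laplacian $\Delta^\rho_X\colon L^2(X,\mu)\to L^2(X,\mu)$, $\mu=\mu_X$, is $$\Delta^\rho_X u(x)=\frac1{\rho^2\mu(B_\rho(x))}\int_{B_\rho(x)}(u(x)-u(y))\,d\mu(y).$$ It is a bounded, non-negative, self-adjoint operator with respect to the inner product $\langle u,v\rangle_{X^\rho}=\rho^2\int_X\mu(B_\rho(x))u(x)v(x)\,d\mu(x)$. The discrete spectrum is the set of isolated eigenvalues of finite multiplicity, and the essential spectrum is the rest of the spectrum. Let $\lambda_\infty(X,\rho)$ be the infimum of the essential spectrum of $\Delta^\rho_X$, with $\lambda_\infty=\infty$ if there is no essential spectrum (i.e. if $L^2(X)$ is finite-dimensional). Let $0=\lambda_1\le\lambda_2\le\dots$ be the eigenvalues of $\Delta^\rho_X$, counted with multiplicities, that are smaller than $\lambda_\infty$; if there are only finitely many of them, set $\lambda_k=\lambda_\infty$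 for all larger $k$. This defines $\lambda_k(X,\rho)\in[0,\infty]$ for all $k\in\mathbb N$. For $R>0$, $\#^\rho_X(R)=\sup\{k\in\mathbb N:\lambda_k(X,\rho)\le R\}$, the number of eigenvalues of $\Delta^\rho_X$ in $[0,R]$ counted with multiplicities (it equals $\infty$ if $R\ge\lambda_\infty(X,\rho)$). For $r>0$, $N_X(r)$ is the maximum number of points in an $r$-separated set in $X$, where $Y\subset X$ is $r$-separated if $d_X(y_1,y_2)\ge r$ for all distinct $y_1,y_2\in Y$. $BIV(\Lambda,\rho,\varepsilon)$ for $X$ (where $0<\varepsilon\le\rho/2$, $\Lambda>0$): for all $x,y\in\operatorname{supp}(\mu_X)$ with $d_X(x,y)\le\rho+\varepsilon$, $\mu_X(B_\rho(x)\cap B_\rho(y))\ge\Lambda^{-1}\mu_X(B_{\rho+\varepsilon}(x))$. *)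

(* Defs.v *)
From HB Require Import structures.
From mathcomp Require Import all_boot all_order all_algebra.
From mathcomp Require Import all_classical all_reals all_analysis.

Set Implicit Arguments.
Unset Strict Implicit.
Unset Printing Implicit Defensive.

Import Order.TTheory GRing.Theory Num.Theory.
Import numFieldNormedType.Exports.

Local Open Scope classical_set_scope.
Local Open Scope ring_scope.

(* MathComp-Analysis. Its measurable types are pointed, so the metric spaces
   below are nonempty. *)
#[short(type="pointedMetricType")]
HB.structure Definition PointedMetric (K : numDomainType) :=
  { M of Pointed M & Metric K M }.

Definition borel (R : realType) (X : pointedMetricType R) :=
  g_sigma_algebraType (@open X).

Record mmSpace (R : realType) := MMSpace {
  mm_carrier :> pointedMetricType R ;
  mm_compact : compact [set: mm_carrier] ;
  mm_measure : {finite_measure set (borel mm_carrier) -> \bar R} }.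

Arguments mm_measure {R} X : rename.

(* Spectral theory of an operator on the real Hilbert space L^2(mu). Elements of
   L^2(mu) are represented by square-integrable functions, equality in L^2(mu)
   being equality mu-almost everywhere, and an operator on L^2(mu) is given by
   its action T on representatives. *)
Section L2_spectrum.
Context {R : realType} {d : measure_display} {X : measurableType d}.
Variable mu : {measure set X -> \bar R}.

Definition L2fun := LfunType mu (lee1n 2).

Definition L2free n (e : 'I_n -> L2fun) :=
  forall a : 'I_n -> R,
    (\sum_(i < n) a i *: e i : L2fun) = cst 0 %[ae mu] -> forall i, a i = 0.

Definition L2dim (V : set L2fun) : \bar R :=
  ereal_sup [set n%:R%:E | n in
    [set n | exists2 e : 'I_n -> L2fun, L2free e & forall i, V (e i)]].

Variable T : (X -> R) -> (X -> R).

Definition shifted_op (l : R) (u : X -> R) : X -> R := fun x => T u x - l * u x.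

(* T - l is onto, and bounded below: it is a bijection of L^2(mu) whose inverse
   is bounded. *)
Definition resolvent_set : set R := [set l |
  (forall f : L2fun, exists u : L2fun, shifted_op l u = f %[ae mu]) /\
  (exists C : R, forall u : L2fun,
    ('N[mu]_2%:E[EFin \o u] <= C%:E * 'N[mu]_2%:E[EFin \o shifted_op l u])%E)].

(* T is real and will be self-adjoint, so that its spectrum is real. *)
Definition spectrum : set R := ~` resolvent_set.

Definition L2eigenspace (l : R) : set L2fun :=
  [set u | shifted_op l u = cst 0 %[ae mu]].

Definition multiplicity (l : R) : \bar R := L2dim (L2eigenspace l).

Definition L2eigenvalue : set R :=
  [set l | exists2 u, L2eigenspace l u & ~ (u : X -> R) = cst 0 %[ae mu]].

Definition discrete_spectrum : set R := [set l |
  [/\ isolated spectrum l, L2eigenvalue l & (multiplicity l < +oo)%E]].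

Definition essential_spectrum : set R := spectrum `\` discrete_spectrum.

Definition lambda_infty : \bar R := ereal_inf [set l%:E | l in essential_spectrum].

Definition eigenvalue_below : set R :=
  [set l | L2eigenvalue l /\ (l%:E < lambda_infty)%E].

Definition eigenvalue_number (l : R) : \bar R :=
  \esum_(s in [set s | eigenvalue_below s /\ s <= l]) multiplicity s.

(* The k-th eigenvalue below lambda_infty, k >= 1, in nondecreasing order and
   counted with multiplicity: the least such l for which the multiplicities of
   the eigenvalues up to l add up to at least k. If there is no such l then the
   infimum is lambda_infty. *)
Definition lambda (k : nat) : \bar R :=
  ereal_inf ([set l%:E | l in [set l | eigenvalue_below l /\
      (k%:R%:E <= eigenvalue_number l)%E]]
    `|` [set lambda_infty]).

(* The supremum of the empty set of indices is 0. *)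
Definition eigenvalue_count (r : R) : \bar R :=
  Order.max 0%E (ereal_sup [set k%:R%:E | k in
    [set k | (0 < k)%N /\ (lambda k <= r%:E)%E]]).

End L2_spectrum.

Section mm_space.
Context {R : realType} (X : mmSpace R).
Local Notation mu := (mm_measure X).

Definition msupport : set X :=
  [set x | forall U : set X, open_nbhs x U -> (0 < mu U)%E].

(* mu (ball x rho) > 0 for x in the support, which has full measure. *)
Definition rho_laplacian (rho : R) (u : X -> R) : X -> R := fun x =>
  (rho ^+ 2 * fine (mu (ball x rho)))^-1 *
  \int[mu]_(y in (ball x rho : set (borel X))) (u x - u y).

Definition spectral_count (rho r : R) : \bar R :=
  eigenvalue_count mu (rho_laplacian rho) r.

Definition r_separated (r : R) (Y : set X) :=
  forall y1 y2, Y y1 -> Y y2 -> y1 <> y2 -> r <= mdist y1 y2.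

Definition packing_number (r : R) : \bar R :=
  ereal_sup [set n%:R%:E | n in
    [set n | exists2 Y : set X, r_separated r Y & (Y #= `I_n)%card]].

Definition BIV (Lambda rho eps : R) :=
  forall x y, msupport x -> msupport y -> mdist x y <= rho + eps ->
    (Lambda^-1%:E * mu (ball x (rho + eps)) <=
       mu (ball x rho `&` ball y rho))%E.

End mm_space.

(* Main.v *)
(* Write w(x) = mu(B_rho(x)) and let <u, v> be the integral of w u v. Cover X by
   the N = N_X(rho/24) cells of a partition subordinate to the balls of radius
   rho/24 around a maximal (rho/24)-separated set. Two points x, y of a cell
   have many common rho-neighbors z by BIV, and averaging
   (u(x) - u(y))^2 <= 2 (u(x) - u(z))^2 + 2 (u(y) - u(z))^2 over z gives a
   Poincare inequality on each cell; summed over the cells it reads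
     <u, u> <= 16 Lambda rho^2 <Delta u, u>
               + (the squares of N bounded linear functionals of u).
   Hence Delta - l is coercive up to a form of rank N when
   l < 1 / (16 Lambda rho^2). Such an l is either in the resolvent set or an
   eigenvalue, and at most N linearly independent eigenvectors have eigenvalues
   that small; in particular there is no essential spectrum below that bound. *)

Require Import Defs.
From mathcomp Require Import all_boot all_order all_algebra finmap.
From mathcomp Require Import all_classical all_reals all_analysis.
From mathcomp Require Import measurable_realfun ring lra.

Set Implicit Arguments.
Unset Strict Implicit.
Unset Printing Implicit Defensive.

Import Order.TTheory GRing.Theory Num.Theory.
Import numFieldNormedType.Exports.

Local Open Scope classical_set_scope.
Local Open Scope ring_scope.

(** * Coercivity up to finite rank *)

(** The spectrum is given only through bounded inverses, so the dichotomy below the threshold is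
    proved by hand. Adding the form of rank N to Delta - l makes it symmetric and coercive, hence
    invertible by an explicit iteration; removing the form again costs an N x N linear system, whose
    singularity is the eigenvalue case.

    Elements of L^2 are functions rather than classes, so <u, v> is only semi-definite. Equality of
    u and f is therefore expressed by pairing: [ip u v = ip f v] for all [v]. The weight w makes
    Delta symmetric, and <u, u> is equivalent to the squared L^2 norm because compactness bounds w
    below by a positive constant on the support.

    The factor 16 is a product of four twos: the squared triangle inequality through z, the
    symmetric roles of x and y in a cell, splitting off the cell mean, and the Dirichlet integral
    running over ordered pairs. *)

Section semi_inner_product.
Context {R : realType} {V : lmodType R}.
Variable ip : V -> V -> R.
Hypothesis ipC : forall u v, ip u v = ip v u.
Hypothesis ip_linl : forall a u v w, ip (a *: u + v) w = a * ip u w + ip v w.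
Hypothesis ip_ge0 : forall u, 0 <= ip u u.

Lemma ip0l u : ip 0 u = 0.
Proof. by have := ip_linl 1 0 0 u; rewrite scaler0 addr0; lra. Qed.

Lemma ipDl u v w : ip (u + v) w = ip u w + ip v w.
Proof. by have := ip_linl 1 u v w; rewrite scale1r mul1r. Qed.

Lemma ipZl a u w : ip (a *: u) w = a * ip u w.
Proof. by have := ip_linl a u 0 w; rewrite addr0 ip0l addr0. Qed.

Lemma ipNl u w : ip (- u) w = - ip u w.
Proof. by rewrite -scaleN1r ipZl mulN1r. Qed.

Lemma ip_suml (I : Type) (r : seq I) (P : pred I) (F : I -> V) w :
  ip (\sum_(i <- r | P i) F i) w = \sum_(i <- r | P i) ip (F i) w.
Proof.
exact: (big_morph (fun u => ip u w) (fun u v => ipDl u v w) (ip0l w)).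
Qed.

Lemma ipDr u v w : ip w (u + v) = ip w u + ip w v.
Proof. by rewrite ipC ipDl !(ipC _ w). Qed.
Lemma ipZr a u w : ip w (a *: u) = a * ip w u.
Proof. by rewrite ipC ipZl (ipC _ w). Qed.
Lemma ipNr u w : ip w (- u) = - ip w u.
Proof. by rewrite ipC ipNl (ipC _ w). Qed.
Lemma ip_sumr (I : Type) (r : seq I) (P : pred I) (F : I -> V) w :
  ip w (\sum_(i <- r | P i) F i) = \sum_(i <- r | P i) ip w (F i).
Proof. by rewrite ipC ip_suml; apply: eq_bigr => i _; rewrite ipC. Qed.

Definition ip_bilin := (ipDl, ipDr, ipNl, ipNr, ipZl, ipZr).

Lemma ip_cauchy_schwarz u v : ip u v ^+ 2 <= ip u u * ip v v.
Proof.
have [v0|v0] := eqVneq (ip v v) 0.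
  have [->|uv] := eqVneq (ip u v) 0; first by rewrite v0 mulr0 expr0n.
  (* For null [v] the form at [u - c *: v] is affine in [c]; this [c] would give it the value -1. *)
  have := ip_ge0 (u - ((ip u u + 1) / (2 * ip u v)) *: v).
  rewrite !ip_bilin v0 (ipC v u).
  have : (ip u u + 1) / (2 * ip u v) * ip u v = (ip u u + 1) / 2 by field.
  by set c := _ / (_ * _); lra.
have vp : 0 < ip v v by rewrite lt_neqAle eq_sym v0 ip_ge0.
have := ip_ge0 (u - (ip u v / ip v v) *: v).
rewrite !ip_bilin (ipC v u).
rewrite [X in 0 <= X](_ : _ = (ip u u * ip v v - ip u v ^+ 2) / ip v v).
  by rewrite pmulr_lge0 ?invr_gt0// subr_ge0.
by field.
Qed.

(** Null vectors pair to 0 with everything, by Cauchy-Schwarz; this is what lets equality of all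
    pairings stand for equality in L^2. *)
Lemma ip_null u v : ip u u = 0 -> ip u v = 0.
Proof.
move=> u0; apply/eqP; rewrite -sqrf_eq0 eq_le sqr_ge0 andbT.
by rewrite (le_trans (ip_cauchy_schwarz u v))// u0 mul0r.
Qed.

Lemma ip_sqrD_le u v : ip (u + v) (u + v) <= 2 * ip u u + 2 * ip v v.
Proof. by have := ip_ge0 (u - v); rewrite !ip_bilin (ipC v u); lra. Qed.

Lemma ip_sqr_sum_le n (F : 'I_n -> V) :
  ip (\sum_i F i) (\sum_i F i) <= 2 ^+ n * \sum_i ip (F i) (F i).
Proof.
elim: n F => [|n ih] F; first by rewrite !big_ord0 ip0l mulr0.
rewrite !big_ord_recl (le_trans (ip_sqrD_le _ _))// exprS mulrDr.
have := ih (fun i => F (lift ord0 i)); set a := ip _ _; set b := \sum_i _.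
have := ip_ge0 (F ord0); set c := ip _ _ => c0 ab.
have : c <= 2 ^+ n * c by rewrite ler_peMl// exprn_ege1// ler1n.
lra.
Qed.

(** Cauchy-Schwarz bounds the square of [ip (B u) u] from above and coercivity from below; dividing
    by [ip u u] leaves the claim, which bounds the inverse of [B]. *)
Lemma coercive_sqr_ge (B : V -> V) (dlt : R) u : 0 < dlt ->
  (forall u, dlt * ip u u <= ip (B u) u) ->
  dlt ^+ 2 * ip u u <= ip (B u) (B u).
Proof.
move=> dlt0 B_ge.
have [u0|u0] := eqVneq (ip u u) 0; first by rewrite u0 mulr0.
have up : 0 < ip u u by rewrite lt_neqAle eq_sym u0 ip_ge0.
rewrite -(ler_pM2r up) (le_trans _ (ip_cauchy_schwarz _ _))//.
rewrite -mulrA -expr2 -exprMn ler_pXn2r ?nnegrE//.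
- by rewrite mulr_ge0 ?ip_ge0// ltW.
- by rewrite (le_trans _ (B_ge u))// mulr_ge0 ?ip_ge0// ltW.
Qed.

(** Completeness, stated for geometrically Cauchy sequences only: a contraction produces just
    these. *)
Hypothesis ip_complete : forall (u : nat -> V) (C q : R), 0 <= q -> q < 1 ->
  (forall n, ip (u n.+1 - u n) (u n.+1 - u n) <= C * q ^+ n) ->
  exists v, ip (v - u n) (v - u n) @[n --> \oo] --> (0 : R).

(* Richardson iteration u <- u - t (B u - f) contracts for small t. *)
Lemma coercive_onto (B : V -> V) (dlt K : R) : 0 < dlt ->
  (forall u v, ip (B u) v = ip u (B v)) ->
  (forall u, dlt * ip u u <= ip (B u) u) ->
  (forall u, ip (B u) (B u) <= K * ip u u) ->
  forall f, exists u, forall v, ip (B u) v = ip f v.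
Proof.
move=> dlt0 Bsym B_ge BK0 f.
have [{BK0}K0 BK] : 0 <= `|K| /\ forall u, ip (B u) (B u) <= `|K| * ip u u.
  by split=> // u; rewrite (le_trans (BK0 u))// ler_wpM2r// ler_norm.
move: `|K| => {}K in K0 BK.
(* [t * K <= dlt] makes the step a contraction with factor [q] for squared norms. The summand
   [dlt ^+ 2] keeps the denominator positive when [K = 0] and gives [t * dlt <= 1], so that
   [0 <= q]. *)
pose t := dlt / (K + dlt ^+ 2); pose q := 1 - t * dlt.
have Kd : 0 < K + dlt ^+ 2 by rewrite ltr_wpDl// exprn_gt0.
have t0 : 0 < t by rewrite divr_gt0.
have q1 : q < 1 by rewrite /q ltrBlDr ltrDl mulr_gt0.
have tE : t * (K + dlt ^+ 2) = dlt by rewrite /t divfK// gt_eqF.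
have q0 : 0 <= q.
  rewrite /q subr_ge0.
  rewrite /t mulrAC ler_pdivrMr// mul1r; nra.
pose S u := u - t *: B u.
have Sq u : ip (S u) (S u) <= q * ip u u.
  rewrite /S !ip_bilin -(ipC (B u) u).
  have := BK u; have := B_ge u; have := ip_ge0 u.
  set x := ip u u; set y := ip (B u) u; set z := ip (B u) (B u) => x0 xy zx.
  have tK : t * K <= dlt by rewrite -[leRHS]tE ler_wpM2l ?lerDl ?sqr_ge0// ltW.
  have : t * z <= t * K * x by rewrite -mulrA ler_wpM2l// ltW.
  have : t * K * x <= dlt * x by rewrite ler_wpM2r.
  rewrite /q; nra.
pose u := fix u n := if n is n'.+1 then u n' - t *: (B (u n') - f) else 0.
(* [B] is linear only up to null vectors: symmetry moves it onto [v], where the linearity of [ip]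
   applies. Hence the equation is tested against [v]. *)
have uS n : forall v, ip (u n.+2 - u n.+1) v = ip (S (u n.+1 - u n)) v.
  move=> v /=; rewrite /S !ip_bilin !Bsym !ip_bilin; ring.
have udiff n : ip (u n.+1 - u n) (u n.+1 - u n) <= t ^+ 2 * ip f f * q ^+ n.
  elim: n => [|n ih].
    have B0 v : ip (B 0) v = 0 by rewrite Bsym ip0l.
    rewrite expr0 mulr1 /= subr0 sub0r !ip_bilin !B0 (ipC f (B 0)) B0.
    by rewrite le_eqVlt; apply/orP; left; apply/eqP; ring.
  rewrite uS ipC uS (le_trans (Sq _))// (exprS q) (mulrCA _ q).
  exact: ler_wpM2l.
have [w uw] := ip_complete q0 q1 udiff.
exists w.
suff w0 : ip (B w - f) (B w - f) = 0.
  by move=> v; apply/eqP; rewrite -subr_eq0 -ipNl -ipDl ip_null.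
apply/le_anti; rewrite ip_ge0 andbT.
(* Bound for the residual at [w]: the first term is the effect of replacing [w] by [u n], the second
   the residual at [u n], which is the increment [u n.+1 - u n] divided by [- t]. *)
pose g n := 2 * K * ip (w - u n) (w - u n) + 2 * (ip f f * q ^+ n).
have g0 : g n @[n --> \oo] --> (0 : R).
  rewrite -[X in _ --> X](_ : 2 * K * 0 + 2 * (ip f f * 0) = _); last by ring.
  apply: cvgD; first exact: cvgMr.
  apply: cvgMr; apply: cvgMr.
  by apply: cvg_expr; rewrite ger0_norm.
apply: (ler_cvg_to (cvg_cst _) g0); apply: nearW => n; rewrite /g.
have -> : ip (B w - f) (B w - f) =
    ip (B (w - u n) + (B (u n) - f)) (B (w - u n) + (B (u n) - f)).
  have E v : ip (B w - f) v = ip (B (w - u n) + (B (u n) - f)) v.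
    by rewrite !ip_bilin !Bsym !ip_bilin; ring.
  by rewrite E ipC E.
rewrite (le_trans (ip_sqrD_le _ _))// lerD//.
  by rewrite -mulrA ler_wpM2l.
rewrite ler_wpM2l//; have := udiff n.
have -> : u n.+1 - u n = (- t) *: (B (u n) - f).
  by rewrite /= addrAC subrr sub0r scaleNr.
rewrite ipZl ipZr mulrA mulrNN -expr2 -mulrA ler_pM2l// exprn_gt0//.
Qed.

Variables (T : V -> V) (m : R) (N : nat) (e : 'I_N -> V).
Hypothesis Tsym : forall u v, ip (T u) v = ip u (T v).
Hypothesis T_ge : forall u, m * ip u u <= ip (T u) u + \sum_i ip (e i) u ^+ 2.

(* On the common kernel of the [ip (e i)] the form of T is at least m, whereas
   it is less than m on every nonzero combination of these eigenvectors. *)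
Lemma eigenvectors_below_le (I : finType) (s : I -> R) (n : I -> nat)
    (f : forall i, 'I_(n i) -> V) :
  injective s -> (forall i, s i < m) ->
  (forall i j v, ip (T (f i j)) v = s i * ip (f i j) v) ->
  (forall i (a : 'I_(n i) -> R), let u := \sum_j a j *: f i j in
    ip u u = 0 -> forall j, a j = 0) ->
  (\sum_i n i <= N)%N.
Proof.
move=> sI sm fE f_free; rewrite leqNgt; apply/negP => nN.
pose J := {i : I & 'I_(n i)}.
pose F (j : J) := f (tag j) (tagged j).
have cJ : #|{: J}| = (\sum_i n i)%N.
  by rewrite card_tagged sumnE big_map enumT; apply: eq_bigr => i _; rewrite card_ord.
pose A : 'M[R]_(#|{: J}|, N) := \matrix_(p, i) ip (e i) (F (enum_val p)).
(* More rows than columns: some nonzero combination of the rows vanishes, that is, some combination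
   of the eigenvectors lies in the common kernel of the [ip (e k)]. *)
have : kermx A != 0.
  rewrite kermx_eq0 /row_free neq_ltn; apply/orP; left.
  by apply: leq_ltn_trans (rank_leq_col A) _; rewrite cJ.
move=> /rowV0Pn[x /sub_kermxP xA x0].
pose a (j : J) := x 0 (enum_rank j).
pose u i := \sum_(j < n i) a (Tagged (fun i => 'I_(n i)) j) *: f i j.
have uE : \sum_i u i = \sum_(j : J) a j *: F j.
  rewrite /u (sig_big_dep xpredT (fun i => xpredT)
    (fun i j => a (Tagged (fun i => 'I_(n i)) j) *: f i j)) /=.
  by apply: eq_bigr => -[i j] _.
have eu k : ip (e k) (\sum_i u i) = 0.
  have := congr1 (fun y : 'rV_N => y 0 k) xA; rewrite !mxE => <-.
  rewrite uE ip_sumr (reindex (@enum_val J predT)); last exact/onW_bij/enum_val_bij.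
  by apply: eq_bigr => p _; rewrite !mxE ipZr /a enum_valK.
have Tu i v : ip (T (u i)) v = s i * ip (u i) v.
  rewrite Tsym !ip_suml mulr_sumr; apply: eq_bigr => j _.
  by rewrite !ipZl -Tsym fE mulrCA.
have uu i k : i != k -> ip (u i) (u k) = 0.
  move=> ik; apply/eqP; have := Tsym (u i) (u k).
  rewrite Tu (ipC (u i) (T _)) Tu (ipC (u k)) => /eqP.
  by rewrite -subr_eq0 -mulrBl mulf_eq0 subr_eq0 (inj_eq sI) (negbTE ik).
have diag i : ip (u i) (\sum_k u k) = ip (u i) (u i).
  by rewrite ip_sumr (bigD1 i)//= big1 ?addr0// => k ki; rewrite uu// eq_sym.
have := T_ge (\sum_i u i).
rewrite (_ : \sum_(i < N) _ = 0) ?addr0; last first.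
  by apply: big1 => k _; rewrite eu expr0n.
rewrite Tsym !ip_suml mulr_sumr -subr_ge0 -sumrB.
under eq_bigr do rewrite -Tsym Tu diag -mulrBl.
rewrite -oppr_le0 -sumrN.
under eq_bigr do rewrite -mulNr opprB.
(* By orthogonality of the [u i], [h] bounds a sum of nonnegative terms [(m - s i) * ip (u i) (u i)]
   by 0. So every [u i] is null, and freeness kills the coefficients. *)
move=> h.
have uu0 i : ip (u i) (u i) = 0.
  have pos k : true -> 0 <= (m - s k) * ip (u k) (u k).
    by move=> _; rewrite mulr_ge0// subr_ge0 ltW.
  have /eqP : \sum_i (m - s i) * ip (u i) (u i) = 0.
    by apply/le_anti; rewrite h sumr_ge0.
  rewrite psumr_eq0// => /allP/(_ i); rewrite mem_index_enum => /(_ isT).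
  by rewrite /= mulf_eq0 subr_eq0 gt_eqF//= => /eqP.
move/eqP: x0; apply; apply/rowP => p; rewrite mxE.
have : a (enum_val p) = 0.
  by case: (enum_val p) => i j; apply: (f_free i _ (uu0 i)).
by rewrite /a enum_valK.
Qed.

Variable M : R.
Hypothesis T_bounded : forall u, ip (T u) (T u) <= M * ip u u.

Variable l : R.
Hypothesis l_lt_m : l < m.

Section finite_rank_perturbation.
Variable B : V -> V.
Hypothesis BE : forall u v,
  ip (B u) v = ip (T u - l *: u + \sum_i ip (e i) u *: e i) v.

Let Bsym u v : ip (B u) v = ip u (B v).
Proof.
rewrite BE (ipC u) BE -(ipC u) !ip_bilin Tsym ip_suml ip_sumr; congr (_ + _).
by apply: eq_bigr => i _; rewrite !ip_bilin (ipC u) mulrC.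
Qed.

Let B_ge u : (m - l) * ip u u <= ip (B u) u.
Proof.
rewrite BE !ip_bilin ip_suml.
under eq_bigr do rewrite ipZl -expr2.
by have := T_ge u; lra.
Qed.

Let B_bounded u : ip (B u) (B u) <=
  (4 * `|M| + 4 * l ^+ 2 +
   2 * (2 ^+ N * (\sum_i ip (e i) (e i) * ip (e i) (e i)))) * ip u u.
Proof.
pose K0 := \sum_i ip (e i) (e i) * ip (e i) (e i); rewrite -/K0.
have K00 : 0 <= K0 by apply: sumr_ge0 => i _; rewrite mulr_ge0.
rewrite BE ipC BE  (le_trans (ip_sqrD_le _ _))//.
have h1 : ip (T u - l *: u) (T u - l *: u) <= (2 * `|M| + 2 * l ^+ 2) * ip u u.
  rewrite (le_trans (ip_sqrD_le _ _))// !ip_bilin.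
  have := T_bounded u; have := ler_norm M; have := ip_ge0 u.
  set a := ip u u; set b := ip _ _; set M' := `|M| => a0 MM bM.
  have : M * a <= M' * a by rewrite ler_wpM2r.
  nra.
have h2 : \sum_i ip (ip (e i) u *: e i) (ip (e i) u *: e i) <= K0 * ip u u.
  rewrite /K0 mulr_suml; apply: ler_sum => i _; rewrite !ip_bilin.
  have := ip_cauchy_schwarz (e i) u; have := ip_ge0 (e i).
  by set a := ip (e i) (e i); set b := ip (e i) u; set c := ip u u; nra.
have := ip_sqr_sum_le (fun i => ip (e i) u *: e i).
set S := \sum_i _ *: _; set S' := \sum_i _ => hS.
have hS' : 2 ^+ N * S' <= 2 ^+ N * (K0 * ip u u) by rewrite ler_wpM2l ?exprn_ge0.
have := ip_ge0 u; set A := ip (T u - _) _ in h1 *; set D := ip S S in hS *.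
move: h1 hS hS'; set a := ip u u; set p := 2 ^+ N.
move: (l ^+ 2) => l2 *.
lra.
Qed.

(* B is invertible, so (T - l) u = f amounts to an N x N linear system for the
   numbers ip (e i) u, with matrix 1 - G; a kernel vector of that matrix gives
   an eigenvector. *)
Lemma eigenvalue_or_resolvent_of_coercive :
  (exists2 u, ip u u != 0 & forall v, ip (T u) v = l * ip u v) \/
  ((forall f, exists u, forall v, ip (T u - l *: u) v = ip f v) /\
   (exists C, forall u, ip u u <= C * ip (T u - l *: u) (T u - l *: u))).
Proof.
have B_onto : forall f, exists u, forall v, ip (B u) v = ip f v.
  by apply: coercive_onto Bsym B_ge B_bounded; rewrite subr_gt0.
have /choice[g gE] : forall i, exists u, forall v, ip (B u) v = ip (e i) v.
  by move=> i; exact: B_onto.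
(* If (T - l) u = f and B h = f, then B u = f + \sum_k a_k e_k with a_k = [ip (e k) u], so u = h +
   \sum_k a_k g_k. Pairing with the e_j gives a (1 - G) = b, where b_k = [ip (e k) h]. *)
pose G : 'M[R]_N := \matrix_(i, j) ip (e j) (g i).
have [D1|] := boolP ((1%:M - G) \in unitmx); last first.
  rewrite -row_free_unit -kermx_eq0 => /rowV0Pn[x /sub_kermxP].
  rewrite mulmxBr mulmx1 => /eqP; rewrite subr_eq0 => /eqP xG x0; left.
  (* For x = x G the vector u = \sum_i x_i g_i has [ip (e i) u] = x_i, so the finite-rank part of B
     u is all of B u and (T - l) u is null. As x is nonzero, u is not null. *)
  have [u [eu Bu]] : exists u, (forall i, ip (e i) u = x 0 i) /\
      (forall v, ip (B u) v = \sum_i x 0 i * ip (e i) v).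
    exists (\sum_i x 0 i *: g i); split=> [i|v].
      by rewrite [in RHS]xG mxE ip_sumr; apply: eq_bigr => j _; rewrite ipZr mxE.
    by rewrite Bsym ip_suml; apply: eq_bigr => i _; rewrite ipZl -Bsym gE.
  exists u.
    apply: contraNneq x0 => u0; apply/eqP/rowP => i; rewrite mxE -eu ipC.
    exact: ip_null.
  move=> v; have := Bu v; rewrite BE !ip_bilin ip_suml.
  under eq_bigr do rewrite ipZl eu.
  by move=> /(canRL (addrK _)); rewrite subrr => /eqP; rewrite subr_eq0 => /eqP.
right.
set D := invmx (1%:M - G).
(* Sherman-Morrison-Woodbury: with a = b D, the correction \sum_j a_j g_j equals \sum_k b_k w_k, so
   [key] expresses the solution explicitly in terms of [h]. *)
pose w k := \sum_j D k j *: g j.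
have key u f h : (forall v, ip (B h) v = ip f v) ->
    ((forall v, ip (T u - l *: u) v = ip f v) <->
     (forall v, ip u v = ip (h + \sum_k ip (e k) h *: w k) v)).
  move=> hf.
  pose b : 'rV[R]_N := \row_k ip (e k) h.
  have wE : forall v, ip (\sum_k ip (e k) h *: w k) v =
      \sum_j (b *m D) 0 j * ip (g j) v.
    move=> v; rewrite ip_suml.
    under eq_bigr do rewrite ipZl ip_suml mulr_sumr.
    rewrite exchange_big /=; apply: eq_bigr => j _; rewrite mxE mulr_suml.
    by apply: eq_bigr => k _; rewrite ipZl !mxE mulrA.
  have eqB x y : (forall v, ip (B x) v = ip (B y) v) -> forall v, ip x v = ip y v.
    move=> xy v; apply/eqP; rewrite -subr_eq0 -ipNl -ipDl ip_null//.
    apply/le_anti; rewrite ip_ge0 andbT.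
    have := B_ge (x - y).
    rewrite [X in _ <= X](_ : _ = 0); last first.
      by rewrite Bsym ipDl ipNl -!Bsym xy subrr.
    by rewrite pmulr_rle0// subr_gt0.
  split => [uf|uh].
    pose a : 'rV[R]_N := \row_k ip (e k) u.
    have Buh : forall v, ip (B u) v = ip (B (h + \sum_j a 0 j *: g j)) v.
      move=> v; rewrite (Bsym (h + _)) ipDl ip_suml -Bsym hf.
      rewrite BE ipDl uf; congr (_ + _); rewrite ip_suml; apply: eq_bigr => j _.
      by rewrite !ipZl -Bsym gE !mxE.
    have uE := eqB _ _ Buh.
    have ab : a = b *m D.
      apply: (can_inj (mulmxK D1)); rewrite mulmxKV// mulmxBr mulmx1.
      apply/rowP => k; rewrite !mxE (ipC (e k)) uE ipDl ip_suml.
      rewrite (eq_bigr (fun j => a 0 j * G j k)) ?addrK 1?ipC//.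
      by move=> j _; rewrite ipZl !mxE (ipC (e k)).
    by move=> v; rewrite uE !ipDl wE ip_suml -ab; under eq_bigr do rewrite ipZl.
  have [a aE aG] : exists2 a, b *m D = a & a = b + a *m G.
    exists (b *m D) => //; apply/eqP; rewrite -subr_eq -[X in X - _]mulmx1.
    by rewrite -mulmxBr mulmxKV.
  have au k : ip (e k) u = a 0 k.
    rewrite ipC uh ipDl wE aE [in RHS]aG [in RHS]mxE; congr (_ + _).
      by rewrite mxE ipC.
    by rewrite mxE; apply: eq_bigr => j _; rewrite mxE ipC.
  move=> v.
  have : ip (B u) v = ip f v + \sum_j a 0 j * ip (e j) v.
    rewrite Bsym uh ipDl -Bsym hf wE aE; congr (_ + _); apply: eq_bigr => j _.
    by rewrite -Bsym gE.
  rewrite {1}BE ipDl ip_suml; under eq_bigr do rewrite ipZl au.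
  by move/addIr.
split=> [f|].
  have [h hf] := B_onto f.
  by exists (h + \sum_k ip (e k) h *: w k); apply/(key _ f h hf).
pose Q := \sum_k ip (e k) (e k) * ip (w k) (w k).
have Q0 : 0 <= Q by apply: sumr_ge0 => k _; rewrite mulr_ge0.
(* Since u = h + \sum_k [ip (e k) h *: w k], the numerator bounds |u|^2 by |h|^2; since B h = (T -
   l) u, coercivity bounds |h|^2 with the factor 1 / (m - l)^2. *)
exists ((2 + 2 * (2 ^+ N * Q)) / (m - l) ^+ 2) => u.
have [h hf] := B_onto (T u - l *: u).
have /(key u _ h hf) uE : forall v, ip (T u - l *: u) v = ip (T u - l *: u) v by [].
have -> : ip (T u - l *: u) (T u - l *: u) = ip (B h) (B h).
  by rewrite hf ipC hf.
rewrite uE ipC uE (le_trans (ip_sqrD_le _ _))//.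
have h1 : (m - l) ^+ 2 * ip h h <= ip (B h) (B h).
  by apply: coercive_sqr_ge B_ge; rewrite subr_gt0.
have ml : 0 < (m - l) ^+ 2 by rewrite exprn_gt0// subr_gt0.
have h2 : \sum_k ip (ip (e k) h *: w k) (ip (e k) h *: w k) <= Q * ip h h.
  rewrite /Q mulr_suml; apply: ler_sum => k _; rewrite !ip_bilin.
  have := ip_cauchy_schwarz (e k) h; have := ip_ge0 (w k).
  set a := ip (w k) (w k); set b := ip (e k) h; set c := ip h h; set d := ip (e k) (e k).
  nra.
rewrite (_ : _ * ip (B h) (B h) = (2 + 2 * (2 ^+ N * Q)) *
  (ip (B h) (B h) / (m - l) ^+ 2)); last by ring.
apply: (@le_trans _ _ ((2 + 2 * (2 ^+ N * Q)) * ip h h)); last first.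
  rewrite ler_wpM2l ?addr_ge0 ?mulr_ge0 ?exprn_ge0//.
  by rewrite ler_pdivlMr// mulrC.
have := ip_sqr_sum_le (fun k => ip (e k) h *: w k) => h3.
have : 2 ^+ N * \sum_k ip (ip (e k) h *: w k) (ip (e k) h *: w k)
    <= 2 ^+ N * (Q * ip h h) by rewrite ler_wpM2l ?exprn_ge0.
move: h3; set s := \sum_i _; set x := ip s s; set y := \sum_i _; set z := 2 ^+ N.
lra.
Qed.

End finite_rank_perturbation.

Theorem eigenvalue_or_resolvent :
  (exists2 u, ip u u != 0 & forall v, ip (T u) v = l * ip u v) \/
  ((forall f, exists u, forall v, ip (T u - l *: u) v = ip f v) /\
   (exists C, forall u, ip u u <= C * ip (T u - l *: u) (T u - l *: u))).
Proof.
by apply: (@eigenvalue_or_resolvent_of_coercive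
  (fun u => T u - l *: u + \sum_i ip (e i) u *: e i)).
Qed.

End semi_inner_product.

(** * Square-integrable functions *)

Section sqr_increments.
Context {R : realType}.

(* Cauchy-Schwarz for a m - a n = \sum_k (a k.+1 - a k) with weights p ^+ k. *)
Lemma sqr_increments_le (a : nat -> R) (p h : R) : 0 < p < 1 ->
  (forall n, \sum_(0 <= k < n) ((a k.+1 - a k) ^+ 2 / p ^+ k) <= h) ->
  forall n m, (n <= m)%N -> (a m - a n) ^+ 2 <= p ^+ n / (1 - p) * h.
Proof.
move=> /andP[p0 p1] ah n m nm.
have q0 : 0 < 1 - p by rewrite subr_gt0.
have pk k : 0 < p ^+ k by rewrite exprn_gt0.
(* The first factor is the geometric sum of [p ^+ k] over n <= k < m, so the induction adds one term
   to each Cauchy-Schwarz factor. *)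
suff: (a m - a n) ^+ 2 <= (p ^+ n - p ^+ m) / (1 - p) *
    \sum_(n <= k < m) ((a k.+1 - a k) ^+ 2 / p ^+ k).
  move=> /le_trans; apply; apply: ler_pM.
  - by rewrite divr_ge0 ?(ltW q0)// subr_ge0 ler_wiXn2l// ltW.
  - by apply: sumr_ge0 => k _; rewrite divr_ge0 ?sqr_ge0// ltW.
  - by rewrite ler_pM2r ?invr_gt0// gerBl ltW.
  - apply: le_trans (ah m); rewrite [leRHS](@big_cat_nat _ _ _ n)//= lerDr.
    by apply: sumr_ge0 => k _; rewrite divr_ge0 ?sqr_ge0// ltW.
elim: m nm => [|m ih].
  by rewrite leqn0 => /eqP ->; rewrite !subrr expr0n mul0r mul0r.
rewrite leq_eqVlt => /predU1P[->|]; first by rewrite !subrr expr0n mul0r mul0r.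
rewrite ltnS => nm; rewrite big_nat_recr//=.
have := ih nm; set B := \sum_(n <= k < m) _; set b := a m.+1 - a m.
have B0 : 0 <= B by apply: sumr_ge0 => k _; rewrite divr_ge0 ?sqr_ge0// ltW.
have -> : a m.+1 - a n = b + (a m - a n) by rewrite /b; ring.
set D := a m - a n; set A := (p ^+ n - p ^+ m) / (1 - p).
have -> : (p ^+ n - p ^+ m.+1) / (1 - p) = A + p ^+ m.
  by rewrite /A exprS; field; rewrite gt_eqF.
set c := p ^+ m; have c0 : 0 < c by exact: pk.
have A0 : 0 <= A by rewrite divr_ge0 ?(ltW q0)// subr_ge0 ler_wiXn2l// ltW.
move=> DAB.
rewrite -(ler_pM2r c0).
rewrite (_ : (A + c) * (B + b ^+ 2 / c) * c =
    A * B * c + A * b ^+ 2 + c ^+ 2 * B + c * b ^+ 2); last first.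
  by field; rewrite gt_eqF.
rewrite (_ : (b + D) ^+ 2 * c =
  b ^+ 2 * c + D ^+ 2 * c + 2 * (b * D * c)); last by ring.
(* Times [A], this is 2 (A b) (D c) <= (A b)^2 + (D c)^2 combined with D^2 <= A B. If [A = 0] then
   [D = 0]. *)
suff : 2 * (b * D * c) <= A * b ^+ 2 + c ^+ 2 * B.
  have : D ^+ 2 * c <= A * B * c by rewrite ler_pM2r.
  nra.
have [A00|Ap] := eqVneq A 0.
  move: DAB; rewrite A00 !mul0r => D0.
  have /eqP : D ^+ 2 = 0 by apply/le_anti; rewrite D0 sqr_ge0.
  by rewrite sqrf_eq0 => /eqP ->; rewrite mulr0 mul0r mulr0 add0r mulr_ge0// sqr_ge0.
have {}Ap : 0 < A by rewrite lt_neqAle eq_sym Ap.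
rewrite -(ler_pM2l Ap).
have := sqr_ge0 (A * b - D * c).
have : c ^+ 2 * D ^+ 2 <= c ^+ 2 * (A * B) by rewrite ler_wpM2l// sqr_ge0.
nra.
Qed.

(** The explicit rate matters: applied pointwise and integrated, it becomes convergence in L^2. *)
Lemma sqr_increments_cvg (a : nat -> R) (p h : R) : 0 < p < 1 ->
  (forall n, \sum_(0 <= k < n) ((a k.+1 - a k) ^+ 2 / p ^+ k) <= h) ->
  exists l, a n @[n --> \oo] --> l /\
    forall n, (l - a n) ^+ 2 <= p ^+ n / (1 - p) * h.
Proof.
move=> p01 ah; have anm := sqr_increments_le p01 ah.
have [p0 p1] := andP p01.
have q0 : 0 < 1 - p by rewrite subr_gt0.
have h0 : 0 <= h by have := ah 0%N; rewrite big_geq.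
have ca : cvgn a.
  apply/cauchy_cvgP/cauchy_exP => e e0.
  have pn0 : p ^+ n / (1 - p) * h @[n --> \oo] --> (0 : R).
    rewrite -[X in _ --> X](_ : 0 / (1 - p) * h = 0); last by rewrite !mul0r.
    by apply: cvgMl; apply: cvgMl; apply: cvg_expr; rewrite ger0_norm ?ltW.
  have e20 : 0 < e ^+ 2 by rewrite exprn_gt0.
  have [n _ /(_ n (leqnn n)) pe] := @cvgr_lt _ _ _ _ _ _ pn0 _ e20.
  exists (a n); exists n => // m /= nm.
  rewrite -ball_normE /ball_ /= distrC -ltr_sqr ?nnegrE ?normr_ge0 ?(ltW e0)//.
  by rewrite real_normK ?num_real// (le_lt_trans (anm _ _ nm)).
exists (limn a); split=> // n.
have lim2 : (a m - a n) ^+ 2 @[m --> \oo] --> (limn a - a n) ^+ 2.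
  by rewrite expr2; apply: cvgM; apply: cvgB => //; exact: cvg_cst.
apply: (ler_cvg_to lim2 (cvg_cst _)).
near=> m; apply: anm; near: m; exact: nbhs_infty_ge.
Unshelve. all: by end_near.
Qed.

End sqr_increments.

Section integrable_real.
Context {d} {X : measurableType d} {R : realType}.
Variable mu : {measure set X -> \bar R}.
Local Notation int1 f := (mu.-integrable [set: X] (EFin \o f)).
Implicit Types f g : X -> R.

Lemma int1_measurable f : int1 f -> measurable_fun [set: X] f.
Proof. by move/measurable_int/measurable_EFinP. Qed.

Lemma int1D f g : int1 f -> int1 g -> int1 (fun x => f x + g x).
Proof. by move=> intf intg; exact: (integrableD measurableT intf intg). Qed.

Lemma int1B f g : int1 f -> int1 g -> int1 (fun x => f x - g x).
Proof. by move=> intf intg; exact: (integrableB measurableT intf intg). Qed.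

Lemma int1Z (a : R) f : int1 f -> int1 (fun x => a * f x).
Proof. by move=> intf; exact: (integrableZl measurableT a intf). Qed.

Lemma int1_le f g : measurable_fun [set: X] f -> int1 g ->
  (forall x, `|f x| <= g x) -> int1 f.
Proof.
move=> mf ig fg; apply: le_integrable ig => //; first exact/measurable_EFinP.
by move=> x _ /=; rewrite lee_fin (le_trans (fg x))// ler_norm.
Qed.

Lemma int1M_bounded f g C : measurable_fun [set: X] f ->
  (forall x, `|f x| <= C) -> int1 g -> int1 (fun x => f x * g x).
Proof.
move=> mf fC ig; apply: (@int1_le _ (fun x => C * `|g x|)).
- by apply: measurable_funM => //; exact: int1_measurable.
- by apply: int1Z; exact: integrable_norm.
- by move=> x; rewrite normrM ler_wpM2r.
Qed.

Lemma ae_eq_Rintegral f g : measurable_fun [set: X] f ->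
  measurable_fun [set: X] g -> f = g %[ae mu] ->
  \int[mu]_x f x = \int[mu]_x g x.
Proof.
move=> mf mg fg; congr fine; apply: ae_eq_integral => //; try exact/measurable_EFinP.
by apply: filterS fg => x /= /(_ I) -> _.
Qed.

Lemma Rintegral_eq0 f : int1 f -> (forall x, 0 <= f x) ->
  \int[mu]_x f x = 0 -> f = cst 0 %[ae mu].
Proof.
move=> intf f0 If0; have mf := int1_measurable intf.
have mf' : measurable_fun [set: X] (EFin \o f) by exact/measurable_EFinP.
have /(ae_eq_integral_abs mu measurableT mf') :
    (\int[mu]_x `|(EFin \o f) x| = 0)%E.
  transitivity (\int[mu]_x f x)%:E; last by rewrite If0.
  rewrite /Rintegral fineK; last exact: integrable_fin_num.
  by apply: eq_integral => x _ /=; rewrite ger0_norm.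
by apply: filterS => x /= /(_ I) [].
Qed.

End integrable_real.

(** * Completeness of L^2 *)

Section L2.
Context {d} {X : measurableType d} {R : realType}.
Variable mu : {measure set X -> \bar R}.
Local Notation int1 f := (mu.-integrable [set: X] (EFin \o f)).
Local Notation L2 := (L2fun mu).

Lemma L2fun_measurable (u : L2) : measurable_fun [set: X] u.
Proof. exact: measurable_funPT. Qed.

Lemma L2fun_int1M (u v : L2) : int1 (fun x => u x * v x).
Proof.
by apply/Lfun1_integrable; apply: Lfun2_mul_Lfun1; exact: LfunP.
Qed.

Lemma L2fun_int1_sqr (u : L2) : int1 (fun x => u x ^+ 2).
Proof. by have := L2fun_int1M u u. Qed.

Lemma Lnorm2E (f : X -> R) : int1 (fun x => f x ^+ 2) ->
  'N[mu]_2%:E[EFin \o f]%E = (Num.sqrt (\int[mu]_x (f x ^+ 2)))%:E.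
Proof.
move=> intf; rewrite unlock /Lnorm.
have -> : (\int[mu]_x `|(EFin \o f) x| `^ 2 = (\int[mu]_x (f x ^+ 2))%:E)%E.
  rewrite /Rintegral fineK; last exact: integrable_fin_num.
  by apply: eq_integral => x _ /=; rewrite powR_mulrn// real_normK// num_real.
rewrite poweR_EFin powR12_sqrt// Rintegral_ge0// => x _; exact: sqr_ge0.
Qed.

Lemma L2fun_of (f : X -> R) : measurable_fun [set: X] f ->
  int1 (fun x => f x ^+ 2) -> exists u : L2, u = f :> (X -> R).
Proof.
move=> mf intf.
have fL : f \in Lfun mu 2.
  rewrite inE; apply/andP; split; rewrite inE//=.
  by rewrite /finite_norm Lnorm2E// ltry.
by exists (Lfun_Sub (lee1n 2) fL); rewrite Lfun_valP.
Qed.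


Lemma sum_geometric_le (c r : R) n : 0 <= c -> 0 <= r -> r < 1 ->
  \sum_(0 <= k < n) c * r ^+ k <= c / (1 - r).
Proof.
move=> c0 r0 r1; have q0 : 0 < 1 - r by rewrite subr_gt0.
suff -> : \sum_(0 <= k < n) c * r ^+ k = c * (1 - r ^+ n) / (1 - r).
  rewrite ler_pM2r ?invr_gt0// ler_piMr// gerBl exprn_ge0//.
elim: n => [|n ih]; first by rewrite big_geq// expr0 subrr mulr0 mul0r.
by rewrite big_nat_recr//= ih exprS; field; rewrite gt_eqF.
Qed.

(** Riesz-Fischer by one dominating function: h = \sum_k (u_{k+1} - u_k)^2 / p^k is integrable, and
    where it is finite u_n converges with squared error at most p^n h / (1 - p). *)
Lemma L2fun_complete (u : nat -> L2) (C q : R) : 0 <= q -> q < 1 ->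
  (forall n, \int[mu]_x ((u n.+1 x - u n x) ^+ 2) <= C * q ^+ n) ->
  exists v : L2, \int[mu]_x ((v x - u n x) ^+ 2) @[n --> \oo] --> (0 : R).
Proof.
move=> q0 q1 uq.
(* The room between [q] and 1 makes both the integrals, of size (q / p)^k, and the weights p^k
   summable. *)
have [p [p0 p1 qp]] : exists p, [/\ 0 < p, p < 1 & q < p].
  by exists ((1 + q) / 2); split; lra.
have p01 : 0 < p < 1 by rewrite p0.
have pk k : 0 < p ^+ k by rewrite exprn_gt0.
have C0 : 0 <= C.
  have := uq 0%N; rewrite expr0 mulr1; apply: le_trans.
  by apply: Rintegral_ge0 => x _; exact: sqr_ge0.
pose g k x := (u k.+1 x - u k x) ^+ 2 / p ^+ k.
have g0 k x : 0 <= g k x by rewrite divr_ge0 ?sqr_ge0// ltW.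
have du k : int1 (fun x => (u k.+1 x - u k x) ^+ 2) := L2fun_int1_sqr (u k.+1 - u k).
have ig k : int1 (g k).
  have := int1Z (p ^+ k)^-1 (du k).
  by congr (integrable _ _ _); apply/funext => x /=; rewrite mulrC.
have mg k : measurable_fun [set: X] (g k) := int1_measurable (ig k).
pose h x := (\sum_(0 <= k <oo) (g k x)%:E)%E.
have h0 x : (0 <= h x)%E by apply: nneseries_ge0 => k _ _; rewrite lee_fin.
have mh : measurable_fun [set: X] h.
  apply: (@ge0_emeasurable_sum _ _ _ _ (fun k x => (g k x)%:E) xpredT).
    by move=> k x _ _; rewrite lee_fin.
  by move=> k _; exact/measurable_EFinP.
have Ih : (\int[mu]_x h x < +oo)%E.
  rewrite integral_nneseries//; last 2 first.
  - by move=> k; exact/measurable_EFinP.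
  - by move=> k x _; rewrite lee_fin.
  apply: (@le_lt_trans _ _ (C / (1 - q / p))%:E); last exact: ltry.
  apply: lime_le.
    by apply: is_cvg_nneseries => k _ _; apply: integral_ge0 => x _; rewrite lee_fin.
  apply: nearW => n.
  have qp0 : 0 <= q / p by rewrite divr_ge0// ltW.
  have qp1 : q / p < 1 by rewrite ltr_pdivrMr// mul1r.
  apply: (le_trans _ (_ : (\sum_(0 <= k < n) C * (q / p) ^+ k)%:E <= _)%E); last first.
    by rewrite lee_fin sum_geometric_le.
  rewrite -sumEFin; apply: lee_sum => k _.
  rewrite -[leLHS]fineK; last exact: (integrable_fin_num measurableT (ig k)).
  rewrite lee_fin -/(Rintegral mu setT (g k)) /g.
  rewrite (_ : \int[mu]_x _ = (\int[mu]_x ((u k.+1 x - u k x) ^+ 2)) / p ^+ k).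
    by rewrite expr_div_n mulrA ler_pM2r ?invr_gt0.
  by rewrite RintegralZr.
(* [fine] sends the value +oo, taken on a null set, to 0. *)
have ih : int1 (fine \o h).
  apply: (@le_integrable _ _ _ mu _ measurableT _ h).
  - by apply/measurable_EFinP; exact: measurableT_comp.
  - move=> x _ /=; have := h0 x; case: (h x) => [r| |]//=.
    by rewrite normr0 leey.
  - apply/integrableP; split=> //.
    by under eq_integral do rewrite gee0_abs//.
pose H := [set x | h x \is a fin_num].
have mH : measurable H.
  by rewrite -[H]setTI; exact: emeasurable_fin_num.
(* Cutting off where [h] is infinite makes the sequence converge at every point, so its limit is
   measurable. *)
pose w n x := \1_H x * u n x.
have mw n : measurable_fun [set: X] (w n).
  apply: measurable_funM; first exact: measurable_indic.
  exact: L2fun_measurable.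
have wl x : exists l, w n x @[n --> \oo] --> l /\
    forall n, (l - w n x) ^+ 2 <= p ^+ n / (1 - p) * fine (h x).
  apply: sqr_increments_cvg => // n.
  have [hx|hx] := boolP (h x \is a fin_num); last first.
    rewrite big1 ?fine_ge0// => k _; rewrite /w indicE memNset ?mul0r; last exact/negP.
    by rewrite subrr expr0n mul0r.
  rewrite -lee_fin fineK// -sumEFin.
  rewrite (eq_bigr (fun k => (g k x)%:E)).
    by apply: nneseries_lim_ge => k _ _; rewrite lee_fin.
  by move=> k _; rewrite /w indicE mem_set// !mul1r.
have /choice[v vP] := wl.
have mv : measurable_fun [set: X] v.
  by apply: (measurable_fun_cvg (h := w)) => // x _; case: (vP x).
have w2 n : int1 (fun x => w n x ^+ 2).
  apply: (int1_le (g := fun x => u n x ^+ 2)); [|exact: L2fun_int1_sqr|].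
    by apply: measurable_funX.
  move=> x; rewrite ger0_norm ?sqr_ge0// /w exprMn ler_piMl ?sqr_ge0//.
have v2 : int1 (fun x => v x ^+ 2).
  apply: (int1_le (g := fun x => 2 * (w 0 x ^+ 2) + 2 / (1 - p) * fine (h x))).
  - by apply: measurable_funX.
  - by apply: int1D; apply: int1Z.
  - move=> x; rewrite ger0_norm ?sqr_ge0//.
    have := (vP x).2 0%N; rewrite expr0 div1r.
    have := sqr_ge0 (v x - 2 * w 0 x).
    rewrite (_ : 2 / (1 - p) * fine (h x) = 2 * ((1 - p)^-1 * fine (h x))); last by ring.
    move: (_^-1 * _) => z; nra.
have [V VE] := L2fun_of mv v2; exists V.
pose K := \int[mu]_x fine (h x) / (1 - p).
apply: (@squeeze_cvgr _ _ _ _ (cst 0) (fun n => K * p ^+ n)).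
- apply: nearW => n; apply/andP; split.
    by apply: Rintegral_ge0 => x _; exact: sqr_ge0.
  have vw : int1 (fun x => (v x - w n x) ^+ 2).
    apply: (int1_le (g := fun x => p ^+ n / (1 - p) * fine (h x))).
    - by apply: measurable_funX; apply: measurable_funB.
    - exact: int1Z.
    - by move=> x; rewrite ger0_norm ?sqr_ge0//; case: (vP x).
  rewrite (_ : \int[mu]_x ((V x - u n x) ^+ 2) = \int[mu]_x ((v x - w n x) ^+ 2)).
    rewrite (_ : K * p ^+ n = \int[mu]_x (p ^+ n / (1 - p) * fine (h x))).
      by apply: le_Rintegral => // [|x _]; [exact: int1Z|case: (vP x)].
    by rewrite RintegralZl// /K; ring.
  apply: ae_eq_Rintegral.
  - by apply: measurable_funX; apply: measurable_funB; exact: L2fun_measurable.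
  - exact: int1_measurable vw.
  have : {ae mu, forall x, [set: X] x -> h x \is a fin_num}.
    apply: integrable_ae => //; apply/integrableP; split=> //.
    by under eq_integral do rewrite gee0_abs//.
  apply: filterS => x /= /(_ I) hx _.
  by rewrite VE /w indicE mem_set ?mul1r.
- exact: cvg_cst.
- rewrite -[X in _ --> X](mulr0 K); apply: cvgMr; apply: cvg_expr.
  by rewrite ger0_norm ?ltW.
Qed.

End L2.

(** * Spectrum below the coercivity threshold *)

Section bottom_of_spectrum.
Context {d} {X : measurableType d} {R : realType}.
Variable mu : {measure set X -> \bar R}.
Local Notation int1 f := (mu.-integrable [set: X] (EFin \o f)).
Local Notation L2 := (L2fun mu).

(** Bounded sizes of free families have a maximum (the empty family is one). A multiplicity thus
    becomes the size of an actual family, which can enter a dimension count. *)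
Lemma L2dim_attained (V : set L2) (N : nat) :
  (forall n (e : 'I_n -> L2), L2free e -> (forall i, V (e i)) -> (n <= N)%N) ->
  exists n (e : 'I_n -> L2),
    [/\ L2free e, forall i, V (e i) & L2dim V = n%:R%:E].
Proof.
move=> VN.
pose P n := `[< exists2 e : 'I_n -> L2, L2free e & forall i, V (e i) >].
have exP : exists n, P n.
  exists 0%N; apply/asboolP.
  by exists (fun i : 'I_0 => 0); [move=> a _ [] | case].
have PN n : P n -> (n <= N)%N by move=> /asboolP[e e1 e2]; exact: VN e1 e2.
have [n /asboolP[e fe Ve] nP] := ex_maxnP exP PN.
exists n, e; split=> //; apply/le_anti/andP; split.
  apply: ge_ereal_sup => _ [k [e' fe' Ve'] <-].
  by rewrite lee_fin ler_nat nP//; apply/asboolP; exists e'.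
by apply: ereal_sup_ubound; exists n => //; exists e.
Qed.

Variables (T : (X -> R) -> (X -> R)) (TV : L2 -> L2).
Hypothesis mT : forall u : L2, measurable_fun [set: X] (T u).
Hypothesis TE : forall u : L2, T u = TV u %[ae mu].

Variable ip : L2 -> L2 -> R.
Hypothesis ipC : forall u v, ip u v = ip v u.
Hypothesis ip_linl : forall a u v w, ip (a *: u + v) w = a * ip u w + ip v w.
Hypothesis ip_ge0 : forall u, 0 <= ip u u.

Variables a b : R.
Hypothesis sqr_le_ip : forall u : L2, \int[mu]_x (u x ^+ 2) <= a * ip u u.
Hypothesis ip_le_sqr : forall u : L2, ip u u <= b * \int[mu]_x (u x ^+ 2).
Hypothesis (a_ge0 : 0 <= a) (b_ge0 : 0 <= b).

Let Rint_sqr_ge0 (u : L2) : 0 <= \int[mu]_x (u x ^+ 2).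
Proof. by apply: Rintegral_ge0 => x _; exact: sqr_ge0. Qed.

Lemma ip_eq0P (u : L2) : ip u u = 0 <-> u = cst 0 %[ae mu].
Proof.
split=> [u0|u0].
  have u2 : \int[mu]_x (u x ^+ 2) = 0.
    by apply/le_anti; rewrite Rint_sqr_ge0 andbT (le_trans (sqr_le_ip u))// u0 mulr0.
  have := Rintegral_eq0 (L2fun_int1_sqr u) (fun x => sqr_ge0 _) u2.
  apply: filterS => x /= /(_ I) /eqP.
  by rewrite sqrf_eq0 => /eqP.
apply/le_anti; rewrite ip_ge0 andbT (le_trans (ip_le_sqr u))//.
rewrite (@ae_eq_Rintegral _ _ _ mu _ (cst 0)).
- by rewrite Rintegral_cst// mul0r mulr0.
- exact: int1_measurable (L2fun_int1_sqr u).
- exact: measurable_cst.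
- by apply: filterS u0 => x /= /(_ I) -> _; rewrite expr0n.
Qed.

Lemma ip_complete (u : nat -> L2) (C q : R) : 0 <= q -> q < 1 ->
  (forall n, ip (u n.+1 - u n) (u n.+1 - u n) <= C * q ^+ n) ->
  exists v, ip (v - u n) (v - u n) @[n --> \oo] --> (0 : R).
Proof.
move=> q0 q1 uC.
have [n|v vu] := L2fun_complete (C := a * C) q0 q1 (u := u).
  by rewrite -mulrA (le_trans (sqr_le_ip (u n.+1 - u n)))// ler_wpM2l.
exists v; apply: (@squeeze_cvgr _ _ _ _ (cst 0)
    (fun n => b * \int[mu]_x ((v x - u n x) ^+ 2))).
- by apply: nearW => n; rewrite ip_ge0 (ip_le_sqr (v - u n)).
- exact: cvg_cst.
- by rewrite -[X in _ --> X](mulr0 b); exact: cvgMr.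
Qed.

Lemma shifted_op_aeE (u : L2) l :
  shifted_op T l u = (TV u - l *: u : L2) %[ae mu].
Proof. by apply: filterS (TE u) => x /= /(_ I) Tu _; rewrite /shifted_op Tu. Qed.

Lemma ae_eq0_ip (u f : L2) :
  (u - f : L2) = cst 0 %[ae mu] <-> forall v, ip u v = ip f v.
Proof.
rewrite -ip_eq0P; split=> [uf v|uf].
  have := ip_null ipC ip_linl ip_ge0 v uf.
  rewrite (ipDl ip_linl) (ipNl ip_linl) => /eqP.
  by rewrite subr_eq0 => /eqP.
by rewrite (ipDl ip_linl) (ipNl ip_linl) uf subrr.
Qed.

Lemma L2eigenspaceP (u : L2) l :
  L2eigenspace T l u <-> forall v, ip (TV u) v = l * ip u v.
Proof.
have E : (forall v, ip (TV u) v = ip (l *: u) v) <->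
         (forall v, ip (TV u) v = l * ip u v).
  by split=> h v; rewrite h (ipZl ip_linl).
rewrite -E -ae_eq0_ip; split; have := shifted_op_aeE u l;
  by apply: filterS2 => x /= /(_ I) -> /(_ I) -> _.
Qed.

Variables (m : R) (N : nat) (e : 'I_N -> L2).
Hypothesis Tsym : forall u v, ip (TV u) v = ip u (TV v).
Hypothesis T_ge : forall u, m * ip u u <= ip (TV u) u + \sum_i ip (e i) u ^+ 2.
Variable M : R.
Hypothesis T_bounded : forall u, ip (TV u) (TV u) <= M * ip u u.

Lemma eigenspaces_below_le (I : finType) (s : I -> R) (n : I -> nat)
    (f : forall i, 'I_(n i) -> L2) :
  injective s -> (forall i, s i < m) ->
  (forall i, L2free (f i)) -> (forall i j, L2eigenspace T (s i) (f i j)) ->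
  (\sum_i n i <= N)%N.
Proof.
move=> sI sm f_free fE.
apply: (eigenvectors_below_le ipC ip_linl ip_ge0 Tsym T_ge sI sm (f := f)).
  by move=> i j; exact/L2eigenspaceP.
by move=> i x; rewrite /= ip_eq0P; exact: f_free.
Qed.

Lemma spectrum_below l : l < m -> spectrum mu T l -> L2eigenvalue mu T l.
Proof.
move=> lm; apply: contra_notP => nl.
have [[u u0 /L2eigenspaceP ul]|[onto [C uC]]] :=
    eigenvalue_or_resolvent ipC ip_linl ip_ge0 ip_complete Tsym T_ge T_bounded lm.
  by exfalso; apply: nl; exists u => // /ip_eq0P; exact/eqP.
split.
  move=> f; have [u /ae_eq0_ip uf] := onto f; exists u.
  have := shifted_op_aeE u l.
  move: uf; apply: filterS2 => x /= /(_ I) uf /(_ I) -> _.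
  by apply/eqP; rewrite -subr_eq0; exact/eqP.
(* The resolvent bound [C] is for [ip]; [a] and [b] convert between [ip] and the L^2 norm on the two
   sides. *)
exists (Num.sqrt (a * `|C| * b)) => u.
have su := shifted_op_aeE u l.
have msu : measurable_fun [set: X] (shifted_op T l u).
  apply: measurable_funB => //; apply: measurable_funM => //.
pose w : L2 := TV u - l *: u.
have su2 : (fun x => shifted_op T l u x ^+ 2) = (fun x => w x ^+ 2) %[ae mu].
  by apply: filterS su => x /= /(_ I) -> _.
have isu : int1 (fun x => shifted_op T l u x ^+ 2).
  have /integrableP[mw wfin] := L2fun_int1_sqr w.
  apply/integrableP; split; first by apply/measurable_EFinP; exact: measurable_funX.
  rewrite (@ae_eq_integral _ _ _ mu _ (fun x => `|(w x ^+ 2)%:E|%E))//.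
  - by apply: measurableT_comp => //; apply/measurable_EFinP; exact: measurable_funX.
  - exact: measurableT_comp.
  - by apply: filterS su2 => x /= /(_ I) -> _.
rewrite (Lnorm2E (L2fun_int1_sqr u)) (Lnorm2E isu).
rewrite (ae_eq_Rintegral _ _ su2); last 2 first.
- exact: measurable_funX.
- exact: int1_measurable (L2fun_int1_sqr w).
rewrite -EFinM -sqrtrM; last by rewrite !mulr_ge0.
rewrite lee_fin ler_wsqrtr// (le_trans (sqr_le_ip u))// -!mulrA ler_wpM2l//.
rewrite (le_trans (uC u))// (@le_trans _ _ (`|C| * ip w w))//.
  by rewrite ler_wpM2r// ler_norm.
by rewrite ler_wpM2l// mulrC ip_le_sqr.
Qed.

Lemma multiplicity_below l : l < m ->
  exists n (f : 'I_n -> L2), [/\ L2free f,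
    forall i, L2eigenspace T l (f i) & multiplicity mu T l = n%:R%:E].
Proof.
move=> lm; apply: (@L2dim_attained _ N) => n f f_free fE.
have := @eigenspaces_below_le unit (fun=> l) (fun=> n) (fun=> f).
rewrite sum_nat_const card_unit mul1n; apply => //.
by case=> [[]].
Qed.

(** One eigenvector per eigenvalue already fills the dimension count. Hence there are finitely many
    eigenvalues below [m], which is why they are isolated. *)
Lemma fset_eigenvalues_le (A : {fset R}) :
  [set` A] `<=` [set l | l < m /\ L2eigenvalue mu T l] -> (#|` A| <= N)%N.
Proof.
move=> Am.
have /choice[f fP] : forall i : A, exists u : L2,
    L2eigenspace T (val i) u /\ ~ (u : X -> R) = cst 0 %[ae mu].
  by move=> i; have [_ [u u1 u2]] := Am _ (valP i); exists u.
have := @eigenspaces_below_le A val (fun=> 1%N) (fun i _ => f i).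
rewrite sum1_card -cardfE; apply.
- exact: val_inj.
- by move=> i; have [] := Am _ (valP i).
- move=> i c; rewrite big_ord1 => cf j; rewrite ord1.
  apply/eqP/negPn/negP => c0; apply: (fP i).2.
  apply: filterS cf => x /= /(_ I) cfx _.
  have /eqP : c ord0 * f i x = 0 by [].
  by rewrite mulf_eq0 (negbTE c0) => /eqP.
- by move=> i _; case: (fP i).
Qed.

Lemma essential_spectrum_ge l : essential_spectrum mu T l -> m <= l.
Proof.
move=> [ls ldisc]; rewrite leNgt; apply/negP => lm; apply: ldisc.
split; last first.
- by have [n [f [_ _ ->]]] := multiplicity_below lm; rewrite ltry.
- exact: spectrum_below.
have fin : finite_set [set k | k < m /\ L2eigenvalue mu T k].
  apply: contrapT => /(infinite_set_fset N.+1)[A AS].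
  by apply/negP; rewrite -leqNgt; exact: fset_eigenvalues_le.
split; first exact/mem_set.
(* Below [m] the spectrum consists of eigenvalues; removing the finitely many others leaves an open
   neighborhood that meets it only in [l]. *)
exists ([set k | k < m] `&` ~` ([set k | k < m /\ L2eigenvalue mu T k] `\ l)).
  apply: open_nbhs_nbhs; split; last by split=> // -[_]; exact.
  apply: openI; first exact: open_lt.
  apply: closed_openC.
  have [+ _] := @accessible_finite_set_closed R.
  apply; first exact/hausdorff_accessible/Rhausdorff.
  exact: finite_setD.
apply/seteqP; split=> [k [[km kl] ks]|_ ->]; last by split=> //; split=> // -[_]; exact.
apply: contrapT => lk; apply: kl; split=> //; split=> //.
exact: spectrum_below.
Qed.

Lemma lambda_infty_ge : (m%:E <= lambda_infty mu T)%E.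
Proof.
apply: le_ereal_inf_tmp => _ [l le <-].
by rewrite lee_fin essential_spectrum_ge.
Qed.

(** The sum is a supremum over finite sets of eigenvalues; on each, free families realizing the
    multiplicities are counted jointly. *)
Lemma eigenvalue_number_below l : l < m -> (eigenvalue_number mu T l <= N%:R%:E)%E.
Proof.
move=> lm; apply: ge_ereal_sup => _ [A [Afin Al] <-].
rewrite fsbig_finite// big_seq_fsetE /=.
have Am (i : fset_set A) : val i < m.
  have : A (val i) by have := valP i; rewrite in_fset_set// => /set_mem.
  by move=> /Al[_ il]; exact: le_lt_trans lm.
have /choice[n nP] : forall i : fset_set A, exists n, exists f : 'I_n -> L2,
    [/\ L2free f, forall j, L2eigenspace T (val i) (f j) &
        multiplicity mu T (val i) = n%:R%:E].
  by move=> i; exact: multiplicity_below.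
pose f i := projT1 (cid (nP i)).
have fP i := projT2 (cid (nP i)).
rewrite (eq_bigr (fun i => (n i)%:R%:E)); last by move=> i _; case: (fP i).
rewrite sumEFin lee_fin -natr_sum ler_nat.
apply: (@eigenspaces_below_le _ val n f) => //.
- by move=> i; case: (fP i).
- by move=> i; case: (fP i).
Qed.

Theorem eigenvalue_count_below r : r < m -> (eigenvalue_count mu T r <= N%:R%:E)%E.
Proof.
move=> rm; rewrite /eigenvalue_count ge_max lee_fin ler0n /=.
apply: ge_ereal_sup => _ [k [_ kr] <-].
(* The infimum [lambda k] lies strictly below [m], so some member of its set does too. That member
   cannot be [lambda_infty], so it is an eigenvalue with at least [k] counted up to it. *)
have /ereal_inf_lt[_ [[l [_ kl] <-]|->]] : (lambda mu T k < m%:E)%E.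
- by rewrite (le_lt_trans kr)// lte_fin.
- by rewrite lte_fin => /eigenvalue_number_below; exact: le_trans.
- by rewrite ltNge lambda_infty_ge.
Qed.

End bottom_of_spectrum.

(** * Laplacians of measurable graphs *)

Lemma int1M_sqr d (X : measurableType d) (R : realType)
    (mu : {measure set X -> \bar R}) (f g : X -> R) :
  measurable_fun [set: X] f -> measurable_fun [set: X] g ->
  mu.-integrable [set: X] (EFin \o (fun x => f x ^+ 2)) ->
  mu.-integrable [set: X] (EFin \o (fun x => g x ^+ 2)) ->
  mu.-integrable [set: X] (EFin \o (fun x => f x * g x)).
Proof.
move=> mf mg f2 g2; apply: (int1_le (g := fun x => f x ^+ 2 + g x ^+ 2)).
- exact: measurable_funM.
- exact: int1D.
- move=> x; rewrite ler_norml; apply/andP; split.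
    by have := sqr_ge0 (f x + g x); nra.
  by have := sqr_ge0 (f x - g x); nra.
Qed.

Lemma int1B_sqr d (X : measurableType d) (R : realType)
    (mu : {measure set X -> \bar R}) (f g : X -> R) :
  measurable_fun [set: X] f -> measurable_fun [set: X] g ->
  mu.-integrable [set: X] (EFin \o (fun x => f x ^+ 2)) ->
  mu.-integrable [set: X] (EFin \o (fun x => g x ^+ 2)) ->
  mu.-integrable [set: X] (EFin \o (fun x => (f x - g x) ^+ 2)).
Proof.
move=> mf mg f2 g2.
apply: (int1_le (g := fun x => 2 * f x ^+ 2 + 2 * g x ^+ 2)).
- by apply: measurable_funX; exact: measurable_funB.
- by apply: int1D; exact: int1Z.
- by move=> x; rewrite ger0_norm ?sqr_ge0//; have := sqr_ge0 (f x + g x); nra.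
Qed.

(** * Fubini for real-valued integrals *)

Section Rintegral_fubini.
Context {d1 d2} {X : measurableType d1} {Y : measurableType d2} {R : realType}.
Variables (m1 : {sigma_finite_measure set X -> \bar R})
  (m2 : {sigma_finite_measure set Y -> \bar R}) (F : X * Y -> R).
Hypothesis intF : (m1 \x m2)%E.-integrable [set: X * Y] (EFin \o F).

Lemma measurable_Rfubini1 :
  measurable_fun [set: X] (fun x => \int[m2]_y F (x, y)).
Proof.
apply: (measurableT_comp (fine_measurable _) (measurable_fubini_F intF)).
exact: measurableT.
Qed.

Lemma int1_Rfubini1 :
  m1.-integrable [set: X] (EFin \o (fun x => \int[m2]_y F (x, y))).
Proof.
apply: le_integrable (integrable_fubini_F intF) => //.
  by apply/measurable_EFinP; exact: measurable_Rfubini1.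
move=> x _; rewrite /= /Rintegral /fubini_F /=.
by case: (\int[m2]_y _)%E => //=; rewrite normr0 leey.
Qed.

Lemma Rfubini1 : \int[m1]_x \int[m2]_y F (x, y) = \int[(m1 \x m2)%E]_z F z.
Proof.
congr fine; rewrite -(integral12_prod_meas1 intF).
(* [fine] changes the inner integral only where it is infinite, on a null set. *)
apply: ae_eq_integral => //.
- by apply/measurable_EFinP; exact: measurable_Rfubini1.
- exact: measurable_fubini_F intF.
- have := integrable_ae measurableT (integrable_fubini_F intF).
  by apply: filterS => x /= /(_ I) h _; rewrite /Rintegral fineK.
Qed.

Lemma Rfubini2 : \int[m2]_y \int[m1]_x F (x, y) = \int[(m1 \x m2)%E]_z F z.
Proof.
congr fine; rewrite -(integral21_prod_meas1 intF).
apply: ae_eq_integral => //.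
- apply/measurable_EFinP.
  apply: (measurableT_comp (fine_measurable _) (measurable_fubini_G intF)).
  exact: measurableT.
- exact: measurable_fubini_G intF.
- apply: filterS (ae_integrable2 intF) => y /= h _.
  by rewrite /Rintegral fineK//; exact: (integrable_fin_num measurableT h).
Qed.

End Rintegral_fubini.

Section graph_laplacian.
Context {d} {X : measurableType d} {R : realType}.
Variable mu : {finite_measure set X -> \bar R}.
Local Notation int1 f := (mu.-integrable [set: X] (EFin \o f)).
Local Notation L2 := (L2fun mu).

(** Points at distance less than rho form the edges [E], and [h] is rho^2. The metric enters the
    estimates only through [E], its sections and the cells. *)
Definition graph_laplacian (E : set (X * X)) (h : R) (u : X -> R) (x : X) : R :=
  (h * fine (mu (xsection E x)))^-1 * \int[mu]_(y in xsection E x) (u x - u y).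

Variable E : set (X * X).
Hypothesis mE : measurable E.
Hypothesis Esym : forall x y, E (x, y) -> E (y, x).
Variables (S : set X) (w0 h : R).
Hypothesis mS : measurable S.
Hypothesis S_full : mu (~` S) = 0.
Hypothesis w0_gt0 : 0 < w0.
Hypothesis h_gt0 : 0 < h.

Let mumu := (mu \x mu)%E.
Local Notation int2 F := (mumu.-integrable [set: X * X] (EFin \o F)).
Let k (z : X * X) : R := \1_E z.
Let w (x : X) : R := fine (mu (xsection E x)).
Hypothesis w_ge : forall x, S x -> w0 <= w x.

Let w_gt0 x : S x -> 0 < w x.
Proof. by move=> Sx; rewrite (lt_le_trans w0_gt0)// w_ge. Qed.

Let k_sym x y : k (x, y) = k (y, x).
Proof.
rewrite /k !indicE; congr (_%:R); congr nat_of_bool.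
by apply/idP/idP => /set_mem/Esym/mem_set.
Qed.

Let k01 z : 0 <= k z <= 1.
Proof. by rewrite /k indicE; case: (_ \in _); rewrite /= ?lexx ler01. Qed.

Let mk : measurable_fun [set: X * X] k.
Proof. exact: measurable_indic. Qed.

Let S_ae : {ae mu, forall x, S x}.
Proof.
exists (~` S); split=> //; first exact: measurableC.
Qed.

Let mf1 (f : X -> R) : measurable_fun [set: X] f ->
  measurable_fun [set: X * X] (fun z => f z.1).
Proof. by move=> mf; exact: measurableT_comp. Qed.

Let mf2 (f : X -> R) : measurable_fun [set: X] f ->
  measurable_fun [set: X * X] (fun z => f z.2).
Proof. by move=> mf; exact: measurableT_comp. Qed.

Let int1c (c : R) : int1 (fun=> c).
Proof. exact: finite_measure_integrable_cst. Qed.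

Let int1u (u : L2) : int1 u.
Proof.
apply: (int1_le (g := fun x => 1 + u x ^+ 2)).
- exact: L2fun_measurable.
- by apply: int1D; [exact: int1c|exact: L2fun_int1_sqr].
- move=> x; rewrite ler_norml; apply/andP; split.
    by have := sqr_ge0 (u x + 1); nra.
  by have := sqr_ge0 (u x - 1); nra.
Qed.

Let int1_cst_fin (f : X -> R) : int1 f ->
  (\int[mu]_x \int[mu]_y `|(f x)%:E| < +oo)%E.
Proof.
move=> /integrableP[mf ffin].
rewrite (_ : (\int[mu]_x _)%E = (\int[mu]_x (`|(f x)%:E| * mu [set: X]))%E); last first.
  by apply: eq_integral => x _; exact: integral_cst.
rewrite ge0_integralZr//; last exact: measurableT_comp.
apply: lte_mul_pinfty; first exact: integral_ge0.
- by rewrite ge0_fin_numE// integral_ge0.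
- by rewrite ltey_eq fin_num_measure.
Qed.

Let int2_1 (f : X -> R) : int1 f -> int2 (fun z => f z.1).
Proof.
move=> intf.
have mF : measurable_fun [set: X * X] (EFin \o (fun z => f z.1)).
  by apply/measurable_EFinP; apply: mf1; exact: int1_measurable intf.
apply: (integrable12ltyP mu mu mF).2; exact: int1_cst_fin intf.
Qed.

Let int2_2 (f : X -> R) : int1 f -> int2 (fun z => f z.2).
Proof.
move=> intf.
have mF : measurable_fun [set: X * X] (EFin \o (fun z => f z.2)).
  by apply/measurable_EFinP; apply: mf2; exact: int1_measurable intf.
apply: (integrable21ltyP mu mu mF).2; exact: int1_cst_fin intf.
Qed.

Let int2k (F : X * X -> R) : int2 F -> int2 (fun z => k z * F z).
Proof.
move=> intF; apply: (@int1M_bounded _ _ _ _ _ _ 1) => // z.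
by have /andP[k0 k1] := k01 z; rewrite ger0_norm.
Qed.

Let int1k x (f : X -> R) : int1 f -> int1 (fun y => k (x, y) * f y).
Proof.
move=> intf; apply: (@int1M_bounded _ _ _ _ _ _ 1) => //.
  by apply: measurableT_comp => //; exact: pair1_measurable.
by move=> z; have /andP[k0 k1] := k01 (x, z); rewrite ger0_norm.
Qed.

Let dl (u : X -> R) (z : X * X) := u z.1 - u z.2.

Let mdl (u : L2) : measurable_fun [set: X * X] (dl u).
Proof.
by apply: measurable_funB; [apply: mf1|apply: mf2]; exact: L2fun_measurable.
Qed.

Let meas_u1 (u : L2) : measurable_fun [set: X * X] (fun z => u z.1).
Proof. by apply: mf1; exact: L2fun_measurable. Qed.
Let meas_u2 (u : L2) : measurable_fun [set: X * X] (fun z => u z.2).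
Proof. by apply: mf2; exact: L2fun_measurable. Qed.

Let sq1 (u : L2) : int2 (fun z => u z.1 ^+ 2).
Proof. exact: (int2_1 (f := fun x => u x ^+ 2)) (L2fun_int1_sqr u). Qed.

Let sq2 (u : L2) : int2 (fun z => u z.2 ^+ 2).
Proof. exact: (int2_2 (f := fun x => u x ^+ 2)) (L2fun_int1_sqr u). Qed.

Let sqdl (u : L2) : int2 (fun z => dl u z ^+ 2).
Proof. by apply: int1B_sqr. Qed.

Let setE_Rintegral x f : \int[mu]_(y in xsection E x) f y =
  \int[mu]_y (k (x, y) * f y).
Proof.
rewrite Rintegral_mkcond; apply: eq_Rintegral => y _.
rewrite patchE mem_xsection /k indicE.
by case: (_ \in _); rewrite ?mul1r ?mul0r.
Qed.

Let wE x : w x = \int[mu]_y k (x, y).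
Proof.
have := setE_Rintegral x (fun=> 1).
rewrite Rintegral_cst ?mul1r; last exact: measurable_xsection.
by rewrite /w => ->; apply: eq_Rintegral => y _; rewrite mulr1.
Qed.

Let int2_k : int2 k.
Proof.
have := int2k (int2_1 (int1c 1)).
by congr (integrable _ _ _); apply/funext => z /=; rewrite mulr1.
Qed.

Let mw : measurable_fun [set: X] w.
Proof.
rewrite (_ : w = fun x => \int[mu]_y k (x, y)) ?funeqE//.
exact: measurable_Rfubini1 int2_k.
Qed.

Let W := fine (mu [set: X]).

Let w_bound x : 0 <= w x <= W.
Proof.
rewrite /w /W fine_ge0//= fine_le ?fin_num_measure//; last first.
  by rewrite le_measure ?inE//; exact: measurable_xsection.
exact: measurable_xsection.
Qed.

Let int1w f : int1 f -> int1 (fun x => w x * f x).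
Proof.
move=> intf; apply: (@int1M_bounded _ _ _ _ _ _ W) => // x.
by have /andP[? ?] := w_bound x; rewrite ger0_norm.
Qed.

Definition wip (u v : L2) : R := \int[mu]_x (w x * (u x * v x)).

Let wipC u v : wip u v = wip v u.
Proof. by apply: eq_Rintegral => x _; rewrite (mulrC (u x)). Qed.

Let wip_linl c u v z : wip (c *: u + v) z = c * wip u z + wip v z.
Proof.
have iu := int1w (L2fun_int1M u z); have iv := int1w (L2fun_int1M v z).
rewrite /wip -RintegralZl// -RintegralD//; last exact: int1Z.
apply: eq_Rintegral => x _.
by rewrite (_ : (c *: u + v) x = c * u x + v x)//; ring.
Qed.

Let wip_ge0 u : 0 <= wip u u.
Proof.
apply: Rintegral_ge0 => x _; have /andP[? _] := w_bound x.
by rewrite mulr_ge0// -expr2 sqr_ge0.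
Qed.

Let sqr_le_wip (u : L2) : \int[mu]_x (u x ^+ 2) <= w0^-1 * wip u u.
Proof.
rewrite ler_pdivlMl// -RintegralZl//; last exact: L2fun_int1_sqr.
rewrite -lee_fin /wip /Rintegral !fineK; last 2 first.
- exact: (integrable_fin_num measurableT (int1w (L2fun_int1M u u))).
- exact: (integrable_fin_num measurableT (int1Z w0 (L2fun_int1_sqr u))).
apply: ae_ge0_le_integral => //.
- by move=> x _; rewrite lee_fin mulr_ge0 ?sqr_ge0// ltW.
- exact: measurable_int (int1Z w0 (L2fun_int1_sqr u)).
- move=> x _; have /andP[? _] := w_bound x.
  by rewrite lee_fin mulr_ge0// -expr2 sqr_ge0.
- exact: measurable_int (int1w (L2fun_int1M u u)).
- apply: filterS S_ae => x Sx _.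
  by rewrite lee_fin -expr2 ler_wpM2r ?sqr_ge0// w_ge.
Qed.

Let wip_le_sqr (u : L2) : wip u u <= W * \int[mu]_x (u x ^+ 2).
Proof.
rewrite -RintegralZl//; last exact: L2fun_int1_sqr.
apply: le_Rintegral => //.
- exact: (int1w (L2fun_int1M u u)).
- exact: (int1Z W (L2fun_int1_sqr u)).
- move=> x _; have /andP[_ ?] := w_bound x.
  by rewrite -expr2 ler_wpM2r// sqr_ge0.
Qed.

Let avg (u : X -> R) x := \int[mu]_y (k (x, y) * u y).

Let int2ku (u : L2) : int2 (fun z => k z * u z.2).
Proof. by apply: int2k; apply: int2_2; exact: int1u. Qed.

Let mavg (u : L2) : measurable_fun [set: X] (avg u).
Proof. exact: (measurable_Rfubini1 (int2ku u)). Qed.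

Let int_kdl (u : L2) x : \int[mu]_y (k (x, y) * (u x - u y)) = w x * u x - avg u x.
Proof.
have ik : int1 (fun y => k (x, y)).
  have := int1k x (int1c 1).
  by congr (integrable _ _ _); apply/funext => z /=; rewrite mulr1.
rewrite wE mulrC -RintegralZl// /avg -RintegralB//.
- by apply: eq_Rintegral => y _ /=; ring.
- exact: int1Z.
- by apply: int1k; exact: int1u.
Qed.

Let lapE (u : L2) x :
  graph_laplacian E h u x = (h * w x)^-1 * (w x * u x - avg u x).
Proof. by rewrite /graph_laplacian setE_Rintegral int_kdl. Qed.

Let mlap (u : L2) : measurable_fun [set: X] (graph_laplacian E h u).
Proof.
(* On nonnegative reals, 0 included, the inverse agrees with the power -1, a measurable function. *)
rewrite (_ : graph_laplacian E h u =
    fun x => (h * w x) `^ (-1) * (w x * u x - avg u x)).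
  apply: measurable_funM.
    apply: (measurableT_comp (measurable_powR (-1))).
    exact: measurable_funM.
  apply: measurable_funB => //; apply: measurable_funM => //.
apply/funext => x; rewrite lapE powR_inv1// mulr_ge0// ?(ltW h_gt0)//.
by case/andP: (w_bound x).
Qed.

Let avg_bound (u : L2) x : `|avg u x| <= \int[mu]_y `|u y|.
Proof.
rewrite (le_trans (le_normr_Rintegral _ _))//; first by apply: int1k; exact: int1u.
apply: le_Rintegral => //.
- by apply: integrable_norm; apply: int1k; exact: int1u.
- by apply: integrable_norm; exact: int1u.
- move=> y _; have /andP[k0 k1] := k01 (x, y).
  by rewrite normrM (ger0_norm k0) ler_piMl.
Qed.

(** On [S] the factor 1 / w is at most 1 / w0, which gives square integrability. On the null
    complement w may vanish, so the representative is set to 0 there. *)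
Let lapL2_ex : exists TV : L2 -> L2, forall u x,
  TV u x = \1_S x * graph_laplacian E h u x.
Proof.
suff /choice[TV TVE] : forall u : L2, exists v : L2, forall x,
    v x = \1_S x * graph_laplacian E h u x by exists TV.
move=> u.
have mf : measurable_fun [set: X] (fun x => \1_S x * graph_laplacian E h u x).
  by apply: measurable_funM => //; exact: measurable_indic.
suff /(L2fun_of mf)[v vE] : int1 (fun x => (\1_S x * graph_laplacian E h u x) ^+ 2).
  by exists v => x; rewrite vE.
pose c := \int[mu]_y `|u y|.
apply: (int1_le (g := fun x =>
  2 * h^-1 ^+ 2 * u x ^+ 2 + 2 * (h^-1 * w0^-1 * c) ^+ 2)).
- exact: measurable_funX.
- by apply: int1D; [apply: int1Z; exact: L2fun_int1_sqr|exact: int1c].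
move=> x; rewrite ger0_norm ?sqr_ge0// indicE.
have [/set_mem Sx|_] := boolP (x \in S); last first.
  by rewrite mul0r expr0n addr_ge0// mulr_ge0 ?sqr_ge0// mulr_ge0// sqr_ge0.
have wx := w_gt0 Sx; rewrite mul1r lapE.
rewrite (_ : (h * w x)^-1 * (w x * u x - avg u x) =
  h^-1 * u x - h^-1 * (w x)^-1 * avg u x); last by field; rewrite !gt_eqF.
have : (h^-1 * (w x)^-1 * avg u x) ^+ 2 <= (h^-1 * w0^-1 * c) ^+ 2.
  rewrite -[leLHS]real_normK ?num_real// -[leRHS]real_normK ?num_real//.
  rewrite ler_pXn2r ?nnegrE//.
  rewrite !normrM ler_pM ?mulr_ge0//.
    rewrite ler_wpM2l// !ger0_norm ?invr_ge0 ?(ltW wx) ?(ltW w0_gt0)//.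
    by rewrite lef_pV2 ?posrE// w_ge.
  by rewrite (le_trans (avg_bound u x))// ler_norm.
move: (h^-1 * (w x)^-1 * avg u x) ((h^-1 * w0^-1 * c) ^+ 2) => A B.
have -> : 2 * h^-1 ^+ 2 * u x ^+ 2 = 2 * (h^-1 * u x) ^+ 2 by ring.
move: (h^-1 * u x) => D; have := sqr_ge0 (D + A); nra.
Qed.

(** The Dirichlet form. Green's formula [TV_dir] identifies it with [2 * h * wip (TV u) v], and the
    symmetry and the boundedness of [TV] are read off from it. *)
Let dir (u v : L2) : R := \int[mumu]_z (k z * (dl u z * dl v z)).

Let int2_dir (u v : L2) : int2 (fun z => k z * (dl u z * dl v z)).
Proof. exact: int2k (int1M_sqr (mdl u) (mdl v) (sqdl u) (sqdl v)). Qed.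

Let int2_kdl1 (u v : L2) : int2 (fun z => k z * (dl u z * v z.1)).
Proof. exact: int2k (int1M_sqr (mdl u) (meas_u1 v) (sqdl u) (sq1 v)). Qed.

Let int2_kdl2 (u v : L2) : int2 (fun z => k z * (dl u z * v z.2)).
Proof. exact: int2k (int1M_sqr (mdl u) (meas_u2 v) (sqdl u) (sq2 v)). Qed.

(* Exchanging the two variables changes the sign of u(x) - u(y). *)
Let kdl_swap (u v : L2) : \int[mumu]_z (k z * (dl u z * v z.2)) =
  - \int[mumu]_z (k z * (dl u z * v z.1)).
Proof.
rewrite -(Rfubini2 (int2_kdl2 u v)) -(Rfubini1 (int2_kdl1 u v)).
rewrite -mulN1r -RintegralZl//; last exact: int1_Rfubini1 (int2_kdl1 u v).
apply: eq_Rintegral => x _.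
have intx : int1 (fun y => k (x, y) * (dl u (x, y) * v x)).
  apply: int1k; rewrite /dl /=.
  have := int1Z (v x) (int1B (int1c (u x)) (int1u u)).
  by congr (integrable _ _ _); apply/funext => y /=; rewrite mulrC.
rewrite -RintegralZl//; apply: eq_Rintegral => y _.
by rewrite k_sym /dl /=; ring.
Qed.

Let dirE (u v : L2) : dir u v = 2 * \int[mumu]_z (k z * (dl u z * v z.1)).
Proof.
rewrite /dir (_ : \int[mumu]_z _ = \int[mumu]_z (k z * (dl u z * v z.1) -
    k z * (dl u z * v z.2))); last first.
  by apply: eq_Rintegral => z _; rewrite {2}/dl; ring.
by rewrite RintegralB// kdl_swap; ring.
Qed.

Let k_sqr_swap (u : L2) : \int[mumu]_z (k z * u z.2 ^+ 2) = wip u u.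
Proof.
have int_1 x (f : L2) : \int[mu]_y (k (x, y) * f x ^+ 2) = w x * (f x * f x).
  rewrite RintegralZr// ?wE ?expr2//.
  have := int1k x (int1c 1).
  by congr (integrable _ _ _); apply/funext => z /=; rewrite mulr1.
rewrite -Rfubini2; last by apply: int2k; exact: sq2.
apply: eq_Rintegral => x _; rewrite -int_1.
by apply: eq_Rintegral => y _; rewrite k_sym.
Qed.

Let k_sqr (u : L2) : \int[mumu]_z (k z * u z.1 ^+ 2) = wip u u.
Proof.
rewrite -k_sqr_swap -Rfubini1; last by apply: int2k; exact: sq1.
rewrite -Rfubini2; last by apply: int2k; exact: sq2.
by apply: eq_Rintegral => x _; apply: eq_Rintegral => y _; rewrite k_sym.
Qed.

Let dir_le (u : L2) : dir u u <= 4 * wip u u.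
Proof.
have i1 := int1Z 2 (int2k (sq1 u)); have i2 := int1Z 2 (int2k (sq2 u)).
rewrite (_ : 4 * wip u u = \int[mumu]_z (2 * (k z * u z.1 ^+ 2) +
    2 * (k z * u z.2 ^+ 2))).
  apply: le_Rintegral => //; first exact: int1D.
  move=> z _; have /andP[k0 _] := k01 z.
  rewrite [leRHS](_ : _ = k z * (2 * u z.1 ^+ 2 + 2 * u z.2 ^+ 2)); last by ring.
  rewrite ler_wpM2l// /dl.
  by have := sqr_ge0 (u z.1 + u z.2); nra.
rewrite RintegralD// !RintegralZl ?k_sqr ?k_sqr_swap; [ring|by []..| |by []|].
  exact: int2k (sq2 u).
exact: int2k (sq1 u).
Qed.

Section operator.
Variable TV : L2 -> L2.
Hypothesis TVE : forall u x, TV u x = \1_S x * graph_laplacian E h u x.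

Let TV_ae (u : L2) : graph_laplacian E h u = TV u %[ae mu].
Proof.
by apply: filterS S_ae => x Sx _; rewrite TVE indicE mem_set// mul1r.
Qed.

Let TV_dir (u v : L2) : 2 * h * wip (TV u) v = dir u v.
Proof.
rewrite dirE -mulrA; congr (2 * _).
rewrite -(Rfubini1 (int2_kdl1 u v)) /wip -RintegralZl//; last first.
  exact: (int1w (L2fun_int1M (TV u) v)).
apply: ae_eq_Rintegral.
- exact: int1_measurable (int1Z h (int1w (L2fun_int1M (TV u) v))).
- exact: measurable_Rfubini1 (int2_kdl1 u v).
apply: filterS S_ae => x Sx _.
have wx := w_gt0 Sx.
rewrite TVE indicE mem_set// mul1r lapE.
rewrite [RHS](_ : _ = \int[mu]_y (k (x, y) * (u x - u y) * v x)); last first.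
  by apply: eq_Rintegral => y _; rewrite /dl mulrA.
rewrite RintegralZr//; last by apply: int1k; exact: int1B (int1c _) (int1u u).
by rewrite int_kdl; field; rewrite !gt_eqF.
Qed.

Let wipTE (u v : L2) : wip (TV u) v = (2 * h)^-1 * dir u v.
Proof. by rewrite -TV_dir mulrA mulVf ?mul1r// mulf_neq0// gt_eqF. Qed.

Let dirC u v : dir u v = dir v u.
Proof. by apply: eq_Rintegral => z _; rewrite (mulrC (dl u z)). Qed.

Let dir_linl c u v z : dir (c *: u + v) z = c * dir u z + dir v z.
Proof.
rewrite /dir -RintegralZl// -RintegralD//; last exact: int1Z.
apply: eq_Rintegral => x _; rewrite /dl.
rewrite (_ : (c *: u + v) x.1 = c * u x.1 + v x.1)//.
by rewrite (_ : (c *: u + v) x.2 = c * u x.2 + v x.2)//; ring.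
Qed.

Let dir_ge0 u : 0 <= dir u u.
Proof.
apply: Rintegral_ge0 => z _; have /andP[k0 _] := k01 z.
by rewrite mulr_ge0// -expr2 sqr_ge0.
Qed.

Let TV_sym u v : wip (TV u) v = wip u (TV v).
Proof. by rewrite (wipC u) !wipTE dirC. Qed.

(** Cauchy-Schwarz for [dir] at [u] and [TV u], with [dir_le] for both; dividing by
    [wip (TV u) (TV u)] leaves 16 / (2 h)^2 = (2 / h)^2. *)
Let TV_bounded u : wip (TV u) (TV u) <= (2 / h) ^+ 2 * wip u u.
Proof.
have [T0|T0] := eqVneq (wip (TV u) (TV u)) 0.
  by rewrite T0 mulr_ge0// sqr_ge0.
have Tp : 0 < wip (TV u) (TV u) by rewrite lt_neqAle eq_sym T0 wip_ge0.
rewrite -(ler_pM2r Tp) -expr2 wipTE exprMn.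
have := ip_cauchy_schwarz dirC dir_linl dir_ge0 u (TV u).
have h1 := dir_le u; have h2 := dir_le (TV u).
have h3 : dir u u * dir (TV u) (TV u) <=
    (4 * wip u u) * (4 * wip (TV u) (TV u)) by rewrite ler_pM.
move=> /le_trans/(_ h3).
rewrite -wipTE => h4.
rewrite [leRHS](_ : _ = (2 * h)^-1 ^+ 2 *
    (4 * wip u u * (4 * wip (TV u) (TV u)))); last by field; rewrite gt_eqF.
by rewrite ler_wpM2l ?sqr_ge0.
Qed.

(** * Poincare inequality on the cells *)

Section cells.
Variables (N : nat) (V : 'I_N -> set X) (L : R).
Hypothesis mV : forall i, measurable (V i).
Hypothesis V_disj : forall i j x, V i x -> V j x -> i = j.
Hypothesis V_cover : forall x, S x -> exists i, V i x.
Hypothesis V_sub : forall i x, V i x -> S x.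
Hypothesis L_gt0 : 0 < L.
Hypothesis V_overlap : forall i x y, V i x -> V i y ->
  w x <= L * fine (mu (xsection E x `&` xsection E y)).

Let overlapE x y : fine (mu (xsection E x `&` xsection E y)) =
  \int[mu]_z (k (x, z) * k (y, z)).
Proof.
transitivity (\int[mu]_(z in xsection E x `&` xsection E y) 1).
  by rewrite Rintegral_cst ?mul1r//; apply: measurableI; exact: measurable_xsection.
rewrite Rintegral_mkcond; apply: eq_Rintegral => z _.
rewrite patchE in_setI !mem_xsection /k !indicE.
by do 2 case: (_ \in _); rewrite /= ?mulr1 ?mulr0.
Qed.

Let int1V i f : int1 f -> int1 (fun x => \1_(V i) x * f x).
Proof.
move=> intf; apply: (@int1M_bounded _ _ _ _ _ _ 1) => //.
by move=> x; rewrite indicE; case: (_ \in _); rewrite /= ?normr1 ?normr0.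
Qed.

Let int1_indic i : int1 (\1_(V i) : X -> R).
Proof.
have := int1V i (int1c 1).
by congr (integrable _ _ _); apply/funext => x /=; rewrite mulr1.
Qed.

Let vol i : R := \int[mu]_x \1_(V i) x.

Let vol_ge0 i : 0 <= vol i.
Proof. by apply: Rintegral_ge0 => x _; rewrite indicE. Qed.

Section poincare.
Variable u : L2.

Let p x := \int[mu]_y (k (x, y) * (dl u (x, y) * dl u (x, y))).

Let p_ge0 x : 0 <= p x.
Proof.
apply: Rintegral_ge0 => y _; have /andP[k0 _] := k01 (x, y).
by rewrite mulr_ge0// -expr2 sqr_ge0.
Qed.

Let int1p : int1 p.
Proof. exact: int1_Rfubini1 (int2_dir u u). Qed.

Let int1_dl x : int1 (fun z => k (x, z) * (dl u (x, z) * dl u (x, z))).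
Proof.
apply: int1k; rewrite /dl /=.
have := @int1B_sqr _ _ _ mu (fun=> u x) u (measurable_cst _)
  (L2fun_measurable u) (int1c (u x ^+ 2)) (L2fun_int1_sqr u).
by congr (integrable _ _ _); apply/funext => z /=; rewrite expr2.
Qed.

(* Going through the common neighbors z of x and y:
   (u(x) - u(y))^2 <= 2 (u(x) - u(z))^2 + 2 (u(y) - u(z))^2. *)
Let pair_le i x y : V i x -> V i y ->
  w x * (u x - u y) ^+ 2 <= 2 * L * (p x + p y).
Proof.
move=> Vx Vy.
apply: (@le_trans _ _ (L * ((\int[mu]_z (k (x, z) * k (y, z))) * (u x - u y) ^+ 2))).
  by rewrite [leRHS]mulrA ler_wpM2r ?sqr_ge0// -overlapE (V_overlap Vx Vy).
rewrite (mulrC 2) -mulrA ler_wpM2l ?(ltW L_gt0)// mulrDr.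
have ik : int1 (fun z => k (x, z) * k (y, z)).
  apply: int1k; have := int1k y (int1c 1).
  by congr (integrable _ _ _); apply/funext => z /=; rewrite mulr1.
rewrite -RintegralZr// -!RintegralZl// -RintegralD//; last 2 first.
- exact: int1Z.
- exact: int1Z.
apply: le_Rintegral => //.
- have := int1Z ((u x - u y) ^+ 2) ik.
  by congr (integrable _ _ _); apply/funext => z /=; rewrite mulrC.
- by apply: int1D; exact: int1Z.
move=> z _; have /andP[a0 a1] := k01 (x, z); have /andP[b0 b1] := k01 (y, z).
rewrite /dl /=; set a := k (x, z) in a0 a1 *; set b := k (y, z) in b0 b1 *.
set s := u x - u z; set t := u y - u z.
have -> : u x - u y = s - t by rewrite /s /t; ring.
have h1 : a * b * (s - t) ^+ 2 <= a * b * (2 * s ^+ 2 + 2 * t ^+ 2).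
  by rewrite ler_wpM2l ?mulr_ge0//; have := sqr_ge0 (s + t); nra.
have h2 : a * b * s ^+ 2 <= a * s ^+ 2.
  by rewrite ler_wpM2r ?sqr_ge0// ler_piMr.
have h3 : a * b * t ^+ 2 <= b * t ^+ 2.
  by rewrite ler_wpM2r ?sqr_ge0// ler_piMl.
nra.
Qed.

(** [pair_le] is integrated over y in the cell, the mean of u is split off by completing a square,
    and the result is integrated over x. *)
Let cell_poincare i :
  \int[mu]_x (\1_(V i) x * (w x * (u x * u x))) <=
  8 * L * \int[mu]_x (\1_(V i) x * p x) +
  4 * W / vol i * (\int[mu]_x (\1_(V i) x * u x)) ^+ 2.
Proof.
set P := \int[mu]_x (_ * p x); set J := \int[mu]_x (_ * u x).
have P0 : 0 <= P by apply: Rintegral_ge0 => x _; rewrite mulr_ge0// indicE.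
have iw := int1V i (int1w (L2fun_int1M u u)).
(* Here [(vol i)^-1] is 0 and the functional term disappears, but the cell is null and the left side
   is 0 as well. *)
have [v0|v0] := eqVneq (vol i) 0.
  rewrite v0 invr0 mulr0 mul0r addr0 [leLHS](_ : _ = 0).
    by rewrite !mulr_ge0// ltW.
  have one0 : (\1_(V i) : X -> R) = cst 0 %[ae mu].
    by apply: Rintegral_eq0 v0 => // x; rewrite indicE.
  rewrite (@ae_eq_Rintegral _ _ _ mu _ (cst 0)).
  - by rewrite Rintegral_cst// mul0r.
  - exact: int1_measurable iw.
  - exact: measurable_cst.
  - by apply: filterS one0 => x /= /(_ I) -> _; rewrite mul0r.
have vp : 0 < vol i by rewrite lt_neqAle eq_sym v0 vol_ge0.
(* [pair_le] integrated over y, after dropping w(x) u(y)^2 >= 0 from the left. *)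
have A x : V i x ->
    w x * u x ^+ 2 * vol i - 2 * w x * u x * J <= 2 * L * (vol i * p x + P).
  move=> Vx.
  have iu := int1V i (int1u u); have ip := int1V i int1p.
  have ipx := int1Z (p x) (int1_indic i).
  rewrite [leLHS](_ : _ = \int[mu]_y (w x * u x ^+ 2 * \1_(V i) y -
      2 * w x * u x * (\1_(V i) y * u y))); last first.
    by rewrite RintegralB//; [rewrite !RintegralZl|exact: int1Z|exact: int1Z].
  rewrite [leRHS](_ : _ = \int[mu]_y (2 * L * (p x * \1_(V i) y +
      \1_(V i) y * p y))); last first.
    rewrite RintegralZl//; last exact: int1D.
    by rewrite RintegralD// RintegralZl// (mulrC (p x)).
  apply: le_Rintegral => //.
  - by apply: int1B; apply: int1Z => //; exact: int1V (int1u u).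
  - by apply: int1Z; apply: int1D; [exact: int1Z|exact: int1V].
  move=> y _; rewrite indicE; have [/set_mem Vy|_] := boolP (y \in V i); last first.
    by rewrite /= !(mulr0, mul0r, subr0, addr0).
  rewrite /= !(mulr1, mul1r) (le_trans _ (pair_le Vx Vy))//.
  have /andP[wx0 _] := w_bound x.
  have : 0 <= w x * u y ^+ 2 by rewrite mulr_ge0// sqr_ge0.
  nra.
pose c1 := 4 * W * (J / vol i) ^+ 2 + 4 * L * (P / vol i).
have B x : \1_(V i) x * (w x * (u x * u x)) <=
    c1 * \1_(V i) x + 4 * L * (\1_(V i) x * p x).
  rewrite indicE; have [/set_mem Vx|_] := boolP (x \in V i); last first.
    by rewrite /= !(mulr0, mul0r, addr0).
  rewrite /= !(mulr1, mul1r) -expr2 /c1.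
  have /andP[wx0 wxW] := w_bound x.
  have := A x Vx; set j := J / vol i; set q := P / vol i.
  have -> : J = j * vol i by rewrite /j divfK.
  have -> : P = q * vol i by rewrite /q divfK.
  rewrite (_ : w x * u x ^+ 2 * vol i - 2 * w x * u x * (j * vol i) =
    (w x * u x ^+ 2 - 2 * w x * u x * j) * vol i); last by ring.
  rewrite (_ : 2 * L * (vol i * p x + q * vol i) =
    2 * L * (p x + q) * vol i); last by ring.
  rewrite ler_pM2r// => h1.
  have h2 : w x * j ^+ 2 <= W * j ^+ 2 by rewrite ler_wpM2r// sqr_ge0.
  (* Equivalently 2 w u j <= w u^2 / 2 + 2 w j^2: half of w u^2 absorbs the cross term, which
     doubles the constants. *)
  have h3 : 0 <= w x * (u x - 2 * j) ^+ 2 by rewrite mulr_ge0// sqr_ge0.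
  nra.
apply: (@le_trans _ _ (\int[mu]_x (c1 * \1_(V i) x + 4 * L * (\1_(V i) x * p x)))).
  apply: le_Rintegral => //; apply: int1D; apply: int1Z => //; exact: int1V.
have i1 := int1_indic i; have i2 := int1V i int1p.
rewrite RintegralD//; [|exact: int1Z|exact: int1Z].
rewrite !RintegralZl//.
rewrite -/(vol i) -/P le_eqVlt; apply/orP; left; apply/eqP.
by rewrite /c1; field.
Qed.

Lemma poincare : wip u u <= 8 * L * dir u u +
  \sum_i 4 * W / vol i * (\int[mu]_x (\1_(V i) x * u x)) ^+ 2.
Proof.
have sumE (f : X -> R) : int1 f -> (forall x, 0 <= f x) ->
    \sum_i \int[mu]_x (\1_(V i) x * f x) = \int[mu]_x (f x).
  move=> intf f0.
  have [int_sum ->] : int1 (fun x => \sum_i (\1_(V i) x * f x)) /\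
      \sum_i \int[mu]_x (\1_(V i) x * f x) =
      \int[mu]_x (\sum_i (\1_(V i) x * f x)).
    elim: (index_enum _) => [|i r [ih1 ih2]].
      split.
        under [X in EFin \o X]eq_fun do rewrite big_nil.
        exact: int1c.
      rewrite big_nil; under eq_Rintegral do rewrite big_nil.
      by rewrite Rintegral_cst// mul0r.
    split.
      under [X in EFin \o X]eq_fun do rewrite big_cons.
      by apply: int1D => //; exact: int1V.
    rewrite big_cons ih2 -RintegralD//; last exact: int1V.
    by apply: eq_Rintegral => x _; rewrite big_cons.
  apply: ae_eq_Rintegral; [exact: int1_measurable int_sum|exact: int1_measurable intf|].
  apply: filterS S_ae => x Sx _.
  have [i Vi] := V_cover Sx.
  rewrite (bigD1 i)//= indicE mem_set// mul1r big1 ?addr0// => j ji.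
  rewrite indicE memNset ?mul0r// => Vj.
  by move/eqP: ji; apply; exact: V_disj Vj Vi.
rewrite /wip -(sumE _ (int1w (L2fun_int1M u u))); last first.
  by move=> x; have /andP[? _] := w_bound x; rewrite mulr_ge0// -expr2 sqr_ge0.
rewrite /dir -(Rfubini1 (int2_dir u u)) -(sumE p int1p p_ge0).
rewrite mulr_sumr -big_split /=; apply: ler_sum => i _; exact: cell_poincare.
Qed.

End poincare.

(** 8 L from [poincare] times 2 h from Green's formula. The square root in [c] lets the squared
    functionals reproduce the mean terms of [poincare] multiplied by [m]. *)
Let m := (16 * L * h)^-1.
Let c i := Num.sqrt (m * (4 * W / vol i)).

(** Riesz representation for the weighted product: the representer is c 1_V / w, square integrable
    because w >= w0 on the cell. *)
Let cell_functional : exists e : 'I_N -> L2,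
  forall i u, wip (e i) u = c i * \int[mu]_x (\1_(V i) x * u x).
Proof.
suff /choice[e eE] : forall i, exists f : L2, forall x,
    f x = c i * (\1_(V i) x * (w x)^-1).
  exists e => i u; rewrite -RintegralZl//; last by apply: int1V; exact: int1u.
  apply: eq_Rintegral => x _; rewrite eE indicE.
  have [/set_mem Vx|_] := boolP (x \in V i); last by rewrite /= !(mul0r, mulr0).
  by rewrite /=; field; rewrite gt_eqF// w_gt0//; exact: V_sub Vx.
move=> i.
have mf : measurable_fun [set: X] (fun x => c i * (\1_(V i) x * (w x)^-1)).
  rewrite (_ : (fun x => _) = fun x => c i * (\1_(V i) x * w x `^ (-1))).
    apply: measurable_funM => //; apply: measurable_funM => //.
    exact: (measurableT_comp (measurable_powR (-1))).
  by apply/funext => x; rewrite powR_inv1//; case/andP: (w_bound x).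
suff /(L2fun_of mf)[f fE] : int1 (fun x => (c i * (\1_(V i) x * (w x)^-1)) ^+ 2).
  by exists f => x; rewrite fE.
apply: (int1_le (g := fun=> (c i * w0^-1) ^+ 2)) => //; first exact: measurable_funX.
move=> x; rewrite ger0_norm ?sqr_ge0// indicE.
have [/set_mem/V_sub Sx|_] := boolP (x \in V i); last first.
  by rewrite /= !(mul0r, mulr0) expr0n sqr_ge0.
have c0 : 0 <= c i by exact: sqrtr_ge0.
rewrite /= mul1r ler_pXn2r ?nnegrE ?mulr_ge0 ?invr_ge0 ?(ltW (w_gt0 Sx))
  ?(ltW w0_gt0)//.
by rewrite ler_wpM2l// lef_pV2 ?posrE ?w_gt0// w_ge.
Qed.

Lemma graph_laplacian_count_aux r : r < m ->
  (eigenvalue_count mu (graph_laplacian E h) r <= N%:R%:E)%E.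
Proof.
have [e eE] := cell_functional.
have m0 : 0 < m by rewrite invr_gt0 !mulr_gt0.
have W0 : 0 <= W by exact: fine_ge0.
apply: (eigenvalue_count_below mlap TV_ae wipC wip_linl wip_ge0
  sqr_le_wip wip_le_sqr _ _ TV_sym _ TV_bounded (e := e)) => //.
- by rewrite invr_ge0 ltW.
move=> u; rewrite wipTE.
have := poincare u; rewrite -(ler_pM2l m0) => /le_trans; apply.
rewrite mulrDr mulr_sumr lerD//.
  rewrite le_eqVlt; apply/orP; left; apply/eqP.
  by rewrite /m; field; rewrite !gt_eqF.
apply: ler_sum => i _; rewrite eE exprMn sqr_sqrtr; first by rewrite -[leRHS]mulrA.
rewrite mulr_ge0 ?(ltW m0)// mulr_ge0 ?invr_ge0 ?vol_ge0//.
by rewrite mulr_ge0.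
Qed.

End cells.

End operator.

Theorem graph_laplacian_count (N : nat) (V : 'I_N -> set X) (L r : R) :
  (forall i, measurable (V i)) ->
  (forall i j x, V i x -> V j x -> i = j) ->
  (forall x, S x -> exists i, V i x) ->
  (forall i x, V i x -> S x) ->
  0 < L ->
  (forall i x y, V i x -> V i y ->
    fine (mu (xsection E x)) <=
      L * fine (mu (xsection E x `&` xsection E y))) ->
  r < (16 * L * h)^-1 ->
  (eigenvalue_count mu (graph_laplacian E h) r <= N%:R%:E)%E.
Proof.
move=> mV Vd Vc Vs L0 Vo rm.
have [TV TVE] := lapL2_ex.
exact: (graph_laplacian_count_aux TVE mV Vd Vc Vs L0 Vo).
Qed.

End graph_laplacian.

(** * Compact metric spaces *)

Section compact_metric.
Context {R : realType} (X : mmSpace R).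
Local Notation mu := (mm_measure X).

Lemma ballE (x y : X) (r : R) : ball x r y <-> mdist x y < r.
Proof. by rewrite ballEmdist. Qed.

Lemma open_mball (x : X) (r : R) : open (ball x r).
Proof.
rewrite openE => y /ballE xy; apply/nbhs_ballP.
exists (r - mdist x y); first by rewrite /= subr_gt0.
move=> z /ballE yz; apply/ballE.
by rewrite (le_lt_trans (metric_triangle x y z))// addrC -ltrBrDr.
Qed.

Lemma measurable_open (U : set X) : open U -> measurable (U : set (borel X)).
Proof. exact: sub_sigma_algebra. Qed.

Lemma measurable_mball (x : X) (r : R) : measurable (ball x r : set (borel X)).
Proof. by apply: measurable_open; exact: open_mball. Qed.

Lemma finite_net (e : R) : 0 < e ->
  exists s : seq X, forall x, exists2 z, z \in s & mdist z x < e.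
Proof.
move=> e0; have := @mm_compact R X; rewrite compact_cover => cX.
have [|x _|D _ DX] := cX X setT (fun z => ball z e).
- by move=> z _; exact: open_mball.
- by exists x => //; apply/ballE; rewrite mdistxx.
exists (enum_fset D) => x; have [z zD /ballE zx] := DX x I.
by exists z.
Qed.

(** Separability scale by scale: row [n] lists a finite net, padded with the default [point]. *)
Lemma dense_net : exists z : nat -> nat -> X,
  forall n x, exists k, mdist (z n k) x < n.+1%:R^-1.
Proof.
have /choice[s sP] : forall n : nat, exists s : seq X,
    forall x, exists2 z, z \in s & mdist z x < n.+1%:R^-1.
  by move=> n; apply: finite_net; rewrite invr_gt0.
exists (fun n k => nth point (s n) k) => n x.
have [z zs zx] := sP n x; exists (index z (s n)).
by rewrite nth_index.
Qed.

Lemma small_radius (e : R) : 0 < e -> exists n : nat, n.+1%:R^-1 < e.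
Proof.
move=> e0; exists (Num.truncn e^-1).
rewrite -ltf_pV2 ?posrE ?invr_gt0// invrK.
exact: truncnS_gt.
Qed.

(** Measurability is for the product of the Borel sigma-algebras, so the set is written as a
    countable union of products of balls around net points. *)
Lemma measurable_mdist_lt (r : R) :
  measurable [set p : borel X * borel X | mdist (p.1 : X) p.2 < r].
Proof.
have [z zP] := dense_net.
pose B n k := ((ball (z n k) n.+1%:R^-1 : set (borel X)) `*`
  (ball (z n k) (r - n.+1%:R^-1) : set (borel X))).
rewrite [X in measurable X](_ : _ = \bigcup_n \bigcup_k B n k).
  do 2 apply: bigcupT_measurable => ?.
  by apply: measurableX; exact: measurable_mball.
apply/seteqP; split=> [[x y] /= xy|[x y] [n _ [k _ [/= /ballE zx /ballE zy]]]].
  have [n nr] : exists n : nat, n.+1%:R^-1 < (r - mdist (x : X) y) / 2.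
    by apply: small_radius; rewrite divr_gt0// subr_gt0.
  have [k zx] := zP n x.
  exists n => //; exists k => //; split=> /=; first exact/ballE.
  apply/ballE; apply: le_lt_trans (metric_triangle _ (x : X) _) _.
  move: nr zx; move: (mdist (x : X) y) (mdist (z n k) _) (_^-1) => a b c; lra.
apply: le_lt_trans (metric_triangle _ (z n k) _) _; rewrite metric_sym.
move: zx zy; move: (mdist _ _) (mdist _ _) (_^-1) => a b c; lra.
Qed.

(** Deleting the null balls of the net removes a null set, as they are countably many. Any
    neighborhood of a remaining point contains a net ball around that point, which has positive
    measure. *)
Lemma full_subset_msupport : exists S : set (borel X),
  [/\ measurable S, mu (~` S) = 0%E & S `<=` @msupport R X].
Proof.
have [z zP] := dense_net.
pose B n k := ball (z n k) n.+1%:R^-1 : set (borel X).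
have mB n k : measurable (B n k) by exact: measurable_mball.
pose D n k := if mu (B n k) == 0%E then B n k else set0.
have mD n k : measurable (D n k) by rewrite /D; case: ifP.
have mDD : measurable (\bigcup_n \bigcup_k D n k).
  by do 2 apply: bigcupT_measurable => ?.
exists (~` \bigcup_n \bigcup_k D n k); split.
- exact: measurableC.
- rewrite setCK; apply/negligibleP => //.
  do 2 apply: negligible_bigcup => ?.
  by apply/negligibleP => //; rewrite /D; case: ifP => [/eqP|].
- move=> x xD U [oU Ux].
  have [e /= e0 xU] : exists2 e : R, 0 < e & ball x e `<=` U.
    by move: oU; rewrite openE => /(_ x Ux) /nbhs_ballP[e e0 eU]; exists e.
  have [n ne] : exists n : nat, n.+1%:R^-1 < e / 2.
    by apply: small_radius; rewrite divr_gt0.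
  have [k zx] := zP n x.
  have BU : B n k `<=` U.
    move=> y /ballE zy; apply: xU; apply/ballE.
    apply: le_lt_trans (metric_triangle _ (z n k) _) _; rewrite metric_sym.
    move: ne zx zy; move: (mdist _ _) (mdist _ _) (_^-1) => a b c; lra.
  apply: (@lt_le_trans _ _ (mu (B n k))); last first.
    by rewrite le_measure ?inE//; exact: measurable_open.
  rewrite lt_neqAle measure_ge0 andbT eq_sym; apply/negP => B0; apply: xD.
  by exists n => //; exists k => //; rewrite /D B0; exact/ballE.
Qed.

(** Around a point of the support, the r-ball contains a ball of radius r / 2 from a finite net;
    that ball contains the point, so its measure is positive. Finitely many positive values have a
    positive lower bound. *)
Lemma ball_measure_bounded_below (r : R) : 0 < r ->
  exists2 w0 : R, 0 < w0 & forall x, @msupport R X x -> w0 <= fine (mu (ball x r)).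
Proof.
move=> r0; have [|s sP] := @finite_net (r / 2); first by rewrite divr_gt0.
pose f z := fine (mu (ball z (r / 2))).
have [w0 w00 w0P] : exists2 w0 : R, 0 < w0 & forall z, z \in s -> 0 < f z -> w0 <= f z.
  elim: s {sP} => [|z s [w0 w00 ih]]; first by exists 1.
  have [fz|fz] := ltP 0 (f z); last first.
    exists w0 => // y; rewrite inE => /predU1P[->|]; last exact: ih.
    by rewrite ltNge fz.
  exists (Num.min w0 (f z)); first by rewrite lt_min w00.
  move=> y; rewrite inE ge_min => /predU1P[->|ys fy]; first by rewrite lexx orbT.
  by rewrite ih.
exists w0 => // x xs.
have [z zs zx] := sP x.
have fz : 0 < f z.
  rewrite /f fine_gt0// xs/=; last first.
    by split; [exact: open_mball|exact/ballE].
  by rewrite ltey_eq fin_num_measure//; exact: measurable_mball.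
rewrite (le_trans (w0P z zs fz))//.
rewrite fine_le ?fin_num_measure//; try exact: measurable_mball.
rewrite le_measure ?inE//; try exact: measurable_mball.
move=> y /ballE zy; apply/ballE.
by rewrite (le_lt_trans (metric_triangle x z y))// metric_sym; lra.
Qed.

(** A point at distance at least [r] from all points of a maximal separated set could be added to
    it. *)
Lemma packing_net (r : R) : 0 < r -> (packing_number X r < +oo)%E ->
  exists N (y : nat -> X), packing_number X r = N%:R%:E /\
    forall x, exists2 i, (i < N)%N & mdist (y i) x < r.
Proof.
move=> r0 pfin.
pose sep n (y : nat -> X) := forall i j, (i < n)%N -> (j < n)%N -> i <> j ->
  r <= mdist (y i) (y j).
have sep_packing n : (exists2 Y : set X, r_separated r Y & (Y #= `I_n)%card) <->
    exists y, sep n y.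
  split=> [[Y Ysep]|[y ysep]].
    move=> /card_esym/card_set_bijP[y [yY yinj _]].
    exists y => i j iN jN ij; apply: Ysep; [exact: yY|exact: yY|].
    by move=> yij; apply: ij; apply: yinj => //; exact/mem_set.
  exists (y @` `I_n).
    by move=> _ _ [i iN <-] [j jN <-] yij; apply: ysep => // ij; apply: yij; rewrite ij.
  apply: inj_card_eq => i j /set_mem iN /set_mem jN yij.
  apply: contrapT => ij; have := ysep i j iN jN ij.
  by rewrite yij mdistxx leNgt r0.
pose P n := `[< exists y, sep n y >].
have P0 : exists n, P n by exists 0%N; apply/asboolP; exists (fun=> point) => i j.
have pge n : P n -> (n%:R%:E <= packing_number X r)%E.
  by move=> /asboolP/sep_packing nY; apply: ereal_sup_ubound; exists n.
have Pb n : P n -> (n <= Num.truncn (fine (packing_number X r)))%N.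
  move=> /pge; have := pge 0%N; have : P 0%N.
    by apply/asboolP; exists (fun=> point) => i j.
  move=> /[swap]/[apply]; move: pfin; case: (packing_number X r) => // p _.
  rewrite !lee_fin => p0 np; rewrite truncn_ge_nat//.
have [N PN Nmax] := ex_maxnP P0 Pb.
have /asboolP[y ysep] := PN; exists N, y; split.
  apply/le_anti; rewrite pge// andbT; apply: ge_ereal_sup => _ [n nY <-].
  by rewrite lee_fin ler_nat Nmax//; apply/asboolP/sep_packing.
move=> x; apply: contrapT => nx.
have xy i : (i < N)%N -> r <= mdist (y i) x.
  by move=> iN; rewrite leNgt; apply/negP => yx; apply: nx; exists i.
suff /Nmax : P N.+1 by rewrite ltnn.
apply/asboolP; exists (fun i => if (i < N)%N then y i else x) => i j.
move=> /ltnSE; rewrite leq_eqVlt => iN /ltnSE; rewrite leq_eqVlt => jN ij.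
move: iN jN ij => /predU1P[->|iN] /predU1P[->|jN] ij //.
- by rewrite ltnn jN metric_sym xy.
- by rewrite ltnn iN xy.
- by rewrite iN jN ysep.
Qed.

End compact_metric.

(** * The rho-Laplacian as a graph Laplacian *)

Theorem theorem7p1 (R : realType) (Lambda : R) (hLambda : 1 <= Lambda) :
  exists c : R, 0 < c /\
    forall (rho : R) (X : mmSpace R), 0 < rho ->
      BIV X Lambda (5 / 6 * rho) (5 / 12 * rho) ->
      (forall x : X, msupport x ->
        (mm_measure X (ball x (5 * rho / 3)) <=
           Lambda%:E * mm_measure X (ball x (5 * rho / 6)))%E) ->
      (spectral_count X rho (c / rho ^+ 2) <= packing_number X (rho / 24))%E.
Proof.
have L0 : 0 < Lambda by rewrite (lt_le_trans ltr01).
(* Half of 1 / (16 Lambda), since the count needs a level strictly below the threshold. *)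
exists (32 * Lambda)^-1; split; first by rewrite invr_gt0 mulr_gt0.
move=> rho X rho0 biv _.
have r0 : 0 < rho / 24 by rewrite divr_gt0.
have [pfin|] := ltP (packing_number X (rho / 24)) +oo%E; last first.
  by rewrite leye_eq => /eqP ->; rewrite leey.
have [N [y [-> yP]]] := packing_net r0 pfin.
pose mu := mm_measure X.
have [S [mS S0 Ssupp]] := full_subset_msupport X.
have [w0 w00 w0P] := ball_measure_bounded_below X rho0.
pose E := [set p : borel X * borel X | mdist (p.1 : X) p.2 < rho].
have xsE x : xsection E x = ball (x : X) rho.
  by apply/seteqP; split=> z /= => [/xsectionP|/ballE zx]; [move/ballE|exact/xsectionP].
rewrite /spectral_count.
have -> : rho_laplacian rho = graph_laplacian mu E (rho ^+ 2) :> ((X -> R) -> (X -> R)).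
  by apply/funext => u; apply/funext => x; rewrite /graph_laplacian xsE.
(* Each point of [S] goes to the first ball that contains it. *)
pose V (i : 'I_N) : set (borel X) := S `&` (ball (y i) (rho / 24) `\`
  \bigcup_(j in [set j | (j < i)%N]) ball (y j) (rho / 24)).
have fm (A : set (borel X)) : measurable A -> mu A \is a fin_num.
  by move=> mA; rewrite fin_num_measure.
apply: (@graph_laplacian_count _ _ _ mu E _ _ S w0 (rho ^+ 2) _ _ _ _ _ N V Lambda) => //.
- exact: measurable_mdist_lt.
- by move=> x z; rewrite /E /= metric_sym.
- by rewrite exprn_gt0.
- by move=> x /Ssupp/w0P; rewrite xsE.
- move=> i; apply: measurableI => //; apply: measurableD; first exact: measurable_mball.
  by apply: bigcup_measurable => j _; exact: measurable_mball.
- move=> i j x [_ [xi nxi]] [_ [xj nxj]]; apply/val_inj => /=.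
  have [ij|ji|//] := ltngtP i j.
    by exfalso; apply: nxj; exists i.
  by exfalso; apply: nxi; exists j.
- move=> x Sx.
  pose P i := (i < N)%N && (mdist (y i) (x : X) < rho / 24).
  have exP : exists i, P i by have [i iN yx] := yP x; exists i; rewrite /P iN.
  have [i /andP[iN yx] imin] := ex_minnP exP.
  exists (Ordinal iN); split=> //; split; first exact/ballE.
  move=> [j /= ji /ballE yj].
  have := imin j; rewrite /P (ltn_trans ji iN) yj => /(_ isT).
  by rewrite leqNgt ji.
- by move=> i x [].
- move=> i x z [/Ssupp xs [/ballE yx _]] [/Ssupp zs [/ballE yz _]].
  rewrite !xsE.
  (* Points of a cell are within rho / 12, so [biv] applies. Its large ball, of radius 5 rho / 4,
     contains the rho-ball, and its balls of radius 5 rho / 6 lie in the rho-balls; hence the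
     overlap constant is [Lambda] itself. *)
  have xz : mdist (x : X) z <= 5 / 6 * rho + 5 / 12 * rho.
    rewrite (le_trans (metric_triangle _ (y i) _))// (metric_sym x); lra.
  have := biv x z xs zs xz.
  set A := ball _ (_ + _); set B := _ `&` _ => AB.
  have sub : mu B \is a fin_num.
    by apply: fm; apply: measurableI; exact: measurable_mball.
  rewrite -ler_pdivrMl// -lee_fin EFinM fineK; last by apply: fm; exact: measurable_mball.
  rewrite fineK; last by apply: fm; apply: measurableI; exact: measurable_mball.
  apply: (@le_trans _ _ (Lambda^-1%:E * mu A)%E).
    rewrite lee_wpmul2l ?lee_fin ?invr_ge0 ?(ltW L0)// le_measure ?inE//;
      try exact: measurable_mball.
    by move=> t /ballE xt; apply/ballE; lra.
  rewrite (le_trans AB)// le_measure ?inE//;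
    try by apply: measurableI; exact: measurable_mball.
  by move=> t [/ballE xt /ballE zt]; split; apply/ballE; lra.
- rewrite -invfM ltf_pV2 ?posrE ?mulr_gt0 ?exprn_gt0//.
  rewrite ltr_pM2r ?exprn_gt0// ltr_pM2r// ltr_nat//.
Qed.
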